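(* There is a universal constant $\hat c>0$ such that the following holds. Let $G\sim\mathcal{G}_{p,q,k}$ on $n=km$ vertices with $p=\alpha\frac{\log m}{m}$ and $q=\beta\frac{\log m}{m}$, where $\alpha,\beta$ are constants. With probability $1-n^{-\Omega(1)}$ over the choice of $G$, if \[ \min_i \nu(i)\ \ge\ \hat c\left(\sqrt{pn/k+qn}+\sqrt{\log n}\right), \] then the semidefinite program \[ \max\ (2A(G)-J)\bullet Y\quad\text{s.t.}\quad Y_{ii}=1\ (\forall i),\quad Y_{ij}\ge -\tfrac{1}{k-1}\ (\forall i,j),\quad Y\succeq 0 \] recovers the hidden partition, i.e. its unique optimal solution is the matrix $Y^*$ with $Y^*_{ij}=1$ if $i,j$ lie in the same hidden cluster and $Y^*_{ij}=-\frac{1}{k-1}$ otherwise.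
   Context: The stochastic block model $\mathcal{G}_{p,q,k}$: the vertex set $V=[n]$, $n=km$, is partitioned into $k$ hidden clusters $P_1,\dots,P_k$ each of size $m=n/k$; a random graph $G$ on $V$ is formed by including each pair in the same cluster as an edge independently with probability $p$ and each pair in different clusters independently with probability $q$, $p>q$. $A=A(G)$ is the adjacency matrix, $J$ is the all-ones matrix, $A\bullet Y=\mathrm{Trace}(A^TY)$, logarithms are natural. $P(i)$ denotes the hidden cluster containing $i$. For a vertex $i$ and cluster $P_t$, $\delta_{i\to P_t}=\sum_{j\in P_t}A[i,j]$; for clusters $P_{t_1},P_{t_2}$, $\delta_{P_{t_1}\to P_{t_2}}=\sum_{i\in P_{t_1}}\sum_{j\in P_{t_2}}A[i,j]$; $\delta^{in}(i)=\delta_{i\to P(i)}$. Define \[ \nu(i)=\delta^{in}(i)-\max_{u,v}\left(\delta_{u\to P(v)}+\delta_{v\to P(u)}-\frac{\delta_{P(v)\to P(u)}}{n/k}\right), \] the maximum being over all pairs of vertices $u,v$. *)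

(* Defs.v *)
From mathcomp Require Import all_boot all_order all_algebra.
From mathcomp Require Import boolp classical_sets reals exp.

Set Implicit Arguments.
Unset Strict Implicit.
Unset Printing Implicit Defensive.

Import Order.TTheory GRing.Theory Num.Theory.

Local Open Scope classical_set_scope.
Local Open Scope ring_scope.

(* The unordered pair {i, j} is encoded as (i, j) with i < j, and a simple
   graph on 'I_n as its set of edges. *)
Definition vpair (n : nat) := {e : 'I_n * 'I_n | (e.1 < e.2)%N}.

Definition graph (n : nat) := {set vpair n}.

Definition adjacent (n : nat) (G : graph n) (i j : 'I_n) : bool :=
  [exists e in G, (val e == (i, j)) || (val e == (j, i))].

Definition adjmx (R : realType) (n : nat) (G : graph n) : 'M[R]_n :=
  \matrix_(i, j) (adjacent G i j)%:R.

(* The hidden partition is given by its cluster map cl; the cluster P_t is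
   the fibre of cl over t. *)
Definition balanced (n k m : nat) (cl : 'I_n -> 'I_k) : Prop :=
  forall t : 'I_k, #|[set i | cl i == t]%SET| = m.

Definition edge_prob (R : realType) (n k : nat) (p q : R) (cl : 'I_n -> 'I_k)
    (e : vpair n) : R :=
  if cl (val e).1 == cl (val e).2 then p else q.

Definition sbm_mass (R : realType) (n k : nat) (p q : R) (cl : 'I_n -> 'I_k)
    (G : graph n) : R :=
  \prod_(e : vpair n)
    (if e \in G then edge_prob p q cl e else 1 - edge_prob p q cl e).

Definition sbm_prob (R : realType) (n k : nat) (p q : R) (cl : 'I_n -> 'I_k)
    (E : set (graph n)) : R :=
  \sum_(G : graph n | G \in E) sbm_mass p q cl G.

Definition delta_vc (R : realType) (n k : nat) (cl : 'I_n -> 'I_k)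
    (A : 'M[R]_n) (i : 'I_n) (t : 'I_k) : R :=
  \sum_(j : 'I_n | cl j == t) A i j.

Definition delta_cc (R : realType) (n k : nat) (cl : 'I_n -> 'I_k)
    (A : 'M[R]_n) (t1 t2 : 'I_k) : R :=
  \sum_(i : 'I_n | cl i == t1) \sum_(j : 'I_n | cl j == t2) A i j.

Definition delta_in (R : realType) (n k : nat) (cl : 'I_n -> 'I_k)
    (A : 'M[R]_n) (i : 'I_n) : R :=
  delta_vc cl A i (cl i).

(* u and v range over vertices in different clusters.  Were pairs inside one
   cluster admitted, then taking u = v with delta_in u largest in its cluster
   would make the supremum at least
     2 delta_in u - (average of delta_in over cl u) >= delta_in u,
   hence nu u <= 0 for some u, and no positive lower bound on min_i nu i
   could ever hold.  The set below is finite, and nonempty as soon as there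
   are two nonempty clusters, so the supremum is a maximum. *)
Definition cross_max (R : realType) (n k : nat) (cl : 'I_n -> 'I_k)
    (A : 'M[R]_n) : R :=
  sup [set x : R | exists u v : 'I_n, cl u != cl v /\
         x = delta_vc cl A u (cl v) + delta_vc cl A v (cl u)
             - delta_cc cl A (cl v) (cl u) / (n%:R / k%:R)].

Definition nu (R : realType) (n k : nat) (cl : 'I_n -> 'I_k)
    (A : 'M[R]_n) (i : 'I_n) : R :=
  delta_in cl A i - cross_max cl A.

Definition mxdot (R : realType) (n : nat) (A Y : 'M[R]_n) : R :=
  \tr (A^T *m Y).

Definition psdmx (R : realType) (n : nat) (Y : 'M[R]_n) : Prop :=
  Y^T = Y /\ forall x : 'cV[R]_n, 0 <= (x^T *m Y *m x) 0 0.

Definition sdp_feasible (R : realType) (n k : nat) (Y : 'M[R]_n) : Prop :=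
  [/\ forall i, Y i i = 1,
      forall i j, - (k%:R - 1)^-1 <= Y i j
    & psdmx Y].

Definition sdp_optimal (R : realType) (n k : nat) (A Y : 'M[R]_n) : Prop :=
  sdp_feasible k Y /\
  forall Z : 'M[R]_n, sdp_feasible k Z ->
    mxdot (2 *: A - const_mx 1) Z <= mxdot (2 *: A - const_mx 1) Y.

Definition partition_mx (R : realType) (n k : nat) (cl : 'I_n -> 'I_k) :
    'M[R]_n :=
  \matrix_(i, j) (if cl i == cl j then 1 else - (k%:R - 1)^-1).

Definition sdp_recovers (R : realType) (n k : nat) (cl : 'I_n -> 'I_k)
    (A : 'M[R]_n) : Prop :=
  forall Y : 'M[R]_n, sdp_optimal k A Y <-> Y = partition_mx R cl.

(* Main.v *)
Require Import Defs.
From mathcomp Require Import all_boot all_order all_algebra.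
From mathcomp Require Import boolp classical_sets reals exp.
From mathcomp Require Import sequences ring lra zify.

Import Order.TTheory GRing.Theory Num.Theory.

Set Implicit Arguments.
Unset Strict Implicit.
Unset Printing Implicit Defensive.

(* The dual certificate is M = diag(nu) - A - Gamma + J/2 (dual_mx), where
   Gamma (slack) is nonnegative, vanishes inside clusters and makes every row
   of M have the same sum m/2 - c over each cluster, c being the maximum
   subtracted in nu.  On vectors summing to 0 on each cluster, the quadratic
   form of M is that of diag(nu) - A, so M is positive there as soon as min nu
   exceeds the norm of A - E A; the same norm bound applied to the indicator
   of one cluster gives c < m/2.

   It remains to bound |A - E A| by a multiple of sqrt(pm + qn) + sqrt(log n)
   with probability 1 - 1/n.  Following Bandeira and van Handel, the moment
   E tr (A - E A)^(2P), with P of order pm + qn + log n, is compared walk by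
   walk with n/(2P) times the same moment of a 2P x 2P symmetric matrix with
   bounded centered i.i.d. entries.  The norm of the latter is O(sqrt P), by a
   union bound over a net of integer vectors.  Taking 2P to be a power of two
   lets repeated squaring and Cauchy-Schwarz replace the spectral theorem. *)

Local Open Scope ring_scope.

(** * Closed walks and their patterns *)

(** A net applied to A - E A itself would lose: when p and q are of order log m / m, its entries
    have tiny variance but are bounded only by 1, and their exponential moments are too large for a
    union bound in dimension n. The comparison passes to entries of constant size in a dimension
    equal to the order of the moment, where a net of exponential cardinality costs only a constant
    after the root of order 2P is taken. Two requirements fix P: it bounds the row sums of E A, so
    that each new vertex of a walk costs at most P; and it is at least log n, so that the factor n
    in front of the moment is absorbed by a constant factor in the threshold. These two are the
    origin of the two square roots in the condition on nu. *)

Fixpoint words (T : finType) (L : nat) : seq (seq T) :=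
  if L is L'.+1 then [seq x :: s | x <- enum T, s <- words T L'] else [:: [::]].

Lemma big_words0 (R : nmodType) (T : finType) (F : seq T -> R) :
  \sum_(s <- words T 0) F s = F [::].
Proof. by rewrite big_seq1. Qed.

Lemma big_wordsS (R : nmodType) (T : finType) (L : nat) (F : seq T -> R) :
  \sum_(s <- words T L.+1) F s = \sum_(x : T) \sum_(s <- words T L) F (x :: s).
Proof. by rewrite /= big_allpairs_dep big_enum. Qed.

Lemma size_words (T : finType) (L : nat) (s : seq T) :
  s \in words T L -> size s = L.
Proof.
elim: L s => [|L IHL] s /=; first by rewrite inE => /eqP->.
by case/allpairsP=> -[x t] /= [_ /IHL <- ->].
Qed.

Arguments words : simpl never.

(** A loop gets [None], since for [i = j] the test of [insub] fails; [oapp f 0] then gives it the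
    value 0 of the diagonal of [graph_mx]. *)
Definition oedge (n : nat) (i j : 'I_n) : option (vpair n) :=
  if (i < j)%N then (insub (i, j) : option (vpair n)) else insub (j, i).

Lemma oedgeP (n : nat) (i j : 'I_n) (e : vpair n) :
  (oedge i j == Some e) = (val e == (i, j)) || (val e == (j, i)).
Proof.
have insE (x y : 'I_n) :
    ((insub (x, y) : option (vpair n)) == Some e) = (val e == (x, y)).
  case: insubP => [u _ uE|/= xy].
    by rewrite -uE val_eqE eq_sym.
  symmetry; apply/negbTE; apply: contra xy => /eqP eE.
  by move: (valP e) => /=; rewrite eE.
have := valP e; rewrite /= /oedge; case: (ltnP i j) => ij; rewrite insE => /= eE.
  suff -> : (sval e == (j, i)) = false by rewrite orbF.
  by apply/negbTE/negP => /eqP E; move: eE; rewrite E /= ltnNge ltnW.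
suff -> : (sval e == (i, j)) = false by [].
by apply/negbTE/negP => /eqP E; move: eE; rewrite E /= ltnNge ij.
Qed.

Lemma oedgeC (n : nat) (i j : 'I_n) : oedge i j = oedge j i.
Proof.
rewrite /oedge; case: (ltngtP i j) => // ij.
by congr insub; congr pair; apply: val_inj; rewrite /= ij.
Qed.

Lemma oedge_None (n : nat) (i j : 'I_n) : (oedge i j == None) = (i == j).
Proof.
rewrite /oedge; case: (ltngtP i j) => /= ij.
- by rewrite insubT /= -val_eqE /= ltn_eqF.
- by rewrite insubT /= -val_eqE /= gtn_eqF.
by rewrite insubF /= -?val_eqE /= ij ?eqxx ?ltnn.
Qed.

Lemma oedge_eq (n : nat) (a b c d : 'I_n) :
  (oedge a b == oedge c d) =
  [|| (a == c) && (b == d), (a == d) && (b == c) | (a == b) && (c == d)].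
Proof.
case E : (oedge a b) => [e|].
  have nab : a != b by rewrite -oedge_None E.
  have /eqP := E; rewrite oedgeP [Some e == _]eq_sym oedgeP (negbTE nab) /= orbF.
  by case/orP=> /eqP ->; rewrite /eq_op /= ?[(b == c) && _]andbC // orbC andbC.
have /eqP := E; rewrite oedge_None => /eqP ->; rewrite [None == _]eq_sym oedge_None eqxx /=.
case: (eqVneq c d) => [->|ncd]; first by rewrite !orbT.
rewrite orbF; symmetry; apply/negbTE/negP.
by case/orP=> /andP[/eqP Ec /eqP Ed]; rewrite -Ec -Ed eqxx in ncd.
Qed.

Lemma oedge_inj (m n : nat) (P : {pred 'I_m}) (f : 'I_m -> 'I_n) :
  {in P &, injective f} ->
  forall a b c d, a \in P -> b \in P -> c \in P -> d \in P ->
  (oedge (f a) (f b) == oedge (f c) (f d)) = (oedge a b == oedge c d).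
Proof. by move=> fI a b c d *; rewrite !oedge_eq !(inj_in_eq fI). Qed.

Fixpoint steps (T : Type) (x : T) (s : seq T) : seq (T * T) :=
  if s is y :: s' then (x, y) :: steps y s' else [::].

(** The closing step comes first, so that dropping the head leaves the open walk on which the
    inductions run. *)
Definition cycle_steps (T : Type) (u : seq T) : seq (T * T) :=
  if u is x :: s then (last x s, x) :: steps x s else [::].

Lemma size_steps (T : Type) (x : T) (s : seq T) : size (steps x s) = size s.
Proof. by elim: s x => //= y s IHs x; rewrite IHs. Qed.

Lemma size_cycle_steps (T : Type) (u : seq T) : size (cycle_steps u) = size u.
Proof. by case: u => //= x s; rewrite size_steps. Qed.

Lemma mem_steps (T : eqType) (x : T) (s : seq T) (e : T * T) :
  e \in steps x s -> (e.1 \in x :: s) && (e.2 \in x :: s).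
Proof.
elim: s x => //= y s IHs x; rewrite inE => /orP[/eqP-> /=|/IHs].
  by rewrite !inE !eqxx !orbT.
by rewrite !inE => /andP[/orP[]-> /orP[]->]; rewrite !orbT.
Qed.

Lemma mem_cycle_steps (T : eqType) (u : seq T) (e : T * T) :
  e \in cycle_steps u -> (e.1 \in u) && (e.2 \in u).
Proof.
case: u => //= x s; rewrite inE => /orP[/eqP->|/mem_steps //].
by apply/andP; split; [apply: mem_last|apply: mem_head].
Qed.

Lemma map_steps (T U : Type) (f : T -> U) (x : T) (s : seq T) :
  steps (f x) (map f s) = [seq (f e.1, f e.2) | e <- steps x s].
Proof. by elim: s x => //= y s IHs x; rewrite IHs. Qed.

Lemma map_cycle_steps (T U : Type) (f : T -> U) (u : seq T) :
  cycle_steps (map f u) = [seq (f e.1, f e.2) | e <- cycle_steps u].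
Proof. by case: u => //= x s; rewrite map_steps last_map. Qed.

Definition edges (n : nat) (l : seq ('I_n * 'I_n)) : seq (option (vpair n)) :=
  [seq oedge e.1 e.2 | e <- l].

(** These are the walks that survive expectation: a loop meets a zero diagonal entry, and an edge
    traversed once contributes a factor of mean 0. *)
Definition repeated (T : eqType) (l : seq (option T)) : bool :=
  (None \notin l) && all (fun o => 1 < count_mem o l)%N l.

Lemma repeated_relabel (m n : nat) (f : 'I_m -> 'I_n) (u : seq 'I_m) :
  {in u &, injective f} ->
  repeated (edges (cycle_steps (map f u))) = repeated (edges (cycle_steps u)).
Proof.
move=> fI; rewrite map_cycle_steps /edges -map_comp /repeated.
have nE : (None \in [seq oedge e.1 e.2 | e <- cycle_steps u])
    = has (fun e => e.1 == e.2) (cycle_steps u).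
  rewrite -has_pred1 has_map; apply: eq_has => e /=.
  by rewrite /= oedge_None.
have nEf : (None \in [seq ((fun e => oedge e.1 e.2) \o
                            (fun e => (f e.1, f e.2))) e | e <- cycle_steps u])
    = has (fun e => e.1 == e.2) (cycle_steps u).
  rewrite -has_pred1 has_map; apply: eq_in_has => e /mem_cycle_steps/andP[e1 e2].
  by rewrite /= oedge_None (inj_in_eq fI).
rewrite nE nEf !all_map; congr andb; apply: eq_in_all => e.
move=> /mem_cycle_steps/andP[e1 e2] /=.
rewrite !count_map; congr leq; apply: eq_in_count => e'.
by move=> /mem_cycle_steps/andP[e1' e2'] /=; rewrite (oedge_inj fI).
Qed.

Lemma repeated_undup (T : eqType) (l : seq (option T)) :
  repeated l -> (2 * size (undup l) <= size l)%N.
Proof.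
case/andP=> _ /allP lall.
have -> : size l = (\sum_(o <- undup l) count_mem o l)%N.
  rewrite -sum1_size -(big_undup_iterop_count _ l predT).
  by apply: eq_bigr => o _; rewrite Monoid.iteropE iter_addn mul1n addn0.
rewrite -sum1_size big_distrr /= big_seq [X in (_ <= X)%N]big_seq.
by apply: leq_sum => o; rewrite mem_undup => /lall.
Qed.

(** A normal form up to injective relabelling: each entry tells how far down the tail the same
    letter recurs. *)
Fixpoint pattern (T : eqType) (s : seq T) : seq nat :=
  if s is x :: s' then index x s' :: pattern s' else [::].

(* index returns the length of the list on an absent element, so the entries
   counted here are first visits. *)
Fixpoint fresh (c : seq nat) : nat :=
  if c is a :: c' then ((a == size c') + fresh c')%N else 0%N.

Lemma size_pattern (T : eqType) (s : seq T) : size (pattern s) = size s.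
Proof. by elim: s => //= x s ->. Qed.

Lemma fresh_pattern (T : eqType) (s : seq T) :
  fresh (pattern s) = size (undup s).
Proof.
elim: s => //= x s ->; rewrite size_pattern.
by rewrite -[_ == _]negbK neq_ltn [(size s < _)%N]ltnNge index_size orbF index_mem;
   case: ifP.
Qed.

(** [f] is built from the end of the list. If the head recurs, equal indices force [f y = x]; if it
    is new on both sides, [f] is redefined at [y] and stays injective because [x] is absent from the
    tail. *)
Lemma pattern_relabel (T U : eqType) (x : T) (s : seq T) (y : U) (t : seq U) :
  pattern (x :: s) = pattern (y :: t) ->
  exists2 f : U -> T, {in y :: t &, injective f} & x :: s = map f (y :: t).
Proof.
elim: s x y t => [|x' s IHs] x y [|y' t] //.
  move=> _; exists (fun=> x) => // a b; rewrite !inE => /eqP-> /eqP->//.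
rewrite [LHS]/= [RHS]/= => -[Ei Ei' Ep].
have [|f fI fE] := IHs x' y' t; first by rewrite /= Ei' Ep.
have sz : size (y' :: t) = size (x' :: s) by rewrite fE size_map.
have Eidx : index x (x' :: s) = index y (y' :: t) by rewrite /= Ei.
have [yt|yt] := boolP (y \in y' :: t).
  have fy : x = f y.
    have xs : x \in x' :: s by rewrite -index_mem Eidx -sz index_mem.
    by rewrite -(nth_index x xs) Eidx fE (nth_map y) ?index_mem // nth_index.
  exists f; last by rewrite fE fy.
  have yin a : a \in [:: y, y' & t] -> a \in y' :: t.
    by rewrite inE => /orP[/eqP->|].
  by move=> a b /yin ain /yin bin; apply: fI.
have xs : x \notin x' :: s by rewrite -index_mem Eidx -sz index_mem.
exists (fun z => if z == y then x else f z); last first.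
  rewrite /= eqxx; congr cons; rewrite fE; apply/eq_in_map => z zt.
  by case: eqP => // zy; rewrite -zy zt in yt.
have fx z : z \in y' :: t -> f z != x.
  by move=> zt; apply: contraNneq xs => <-; rewrite fE map_f.
move=> a b; rewrite [a \in y :: _]in_cons [b \in y :: _]in_cons.
case: (eqVneq a y) => [->|ay] /=; case: (eqVneq b y) => [->//|by_] //= ain bin.
- by move=> E; have := fx b bin; rewrite -E eqxx.
- by move=> E; have := fx a ain; rewrite E eqxx.
by move=> E; apply: fI.
Qed.

(** Equal edges share their endpoints, so an edge at an unvisited vertex is new; [x != z] excludes
    loops, which all have the code [None]. *)
Lemma new_vertex_edge (n : nat) (x z y : 'I_n) (s : seq 'I_n) :
  x != z -> x \notin y :: s -> oedge x z \notin edges (steps y s).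
Proof.
move=> xz; elim: s y => //= t s IHs y; rewrite !inE !negb_or => /and3P[xy xt xs].
rewrite (IHs t) ?andbT ?inE ?negb_or ?xt // oedge_eq.
by rewrite (negbTE xy) (negbTE xt) (negbTE xz).
Qed.

Section FirstVisits.
Variables (R : numDomainType) (n : nat) (w : option (vpair n) -> R).
Hypotheses (w0 : forall o, 0 <= w o) (w1 : forall o, w o <= 1).

(* Walks are listed from the last vertex backwards: x \in s says that x was
   visited earlier. *)
Fixpoint first_visits (u : seq 'I_n) : R :=
  if u is x :: s then
    (if s is y :: _ then if x \in s then 1 else w (oedge x y) else 1) *
    first_visits s
  else 1.

Lemma first_visits_ge0 (u : seq 'I_n) : 0 <= first_visits u.
Proof. by elim: u => //= x [|y s] IHs; rewrite mulr_ge0 //; case: ifP. Qed.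

Lemma prod_edges_ge0 (l : seq (option (vpair n))) : 0 <= \prod_(o <- l) w o.
Proof. exact: prodr_ge0. Qed.

(** Every first visit uses an edge new to the walk, whose factor is kept; the other distinct edges
    have weight at most 1 and are dropped. The kept edges form a spanning tree of the walk. *)
Lemma prod_steps_le (x : 'I_n) (s : seq 'I_n) :
  \prod_(o <- undup (edges (steps x s))) w o <= first_visits (x :: s).
Proof.
elim: s x => [|y s IHs] x; first by rewrite /= big_nil !mulr1.
rewrite [first_visits _]/= [edges _]/= [undup _]/=.
have fv := first_visits_ge0 (y :: s).
have [xs|xs] := boolP (x \in y :: s).
  rewrite mul1r; case: ifP => _; first exact: IHs.
  by rewrite big_cons (le_trans _ (IHs y)) // ler_piMl // prod_edges_ge0.
have xy : x != y by apply: contraNneq xs => ->; rewrite mem_head.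
by rewrite (negbTE (new_vertex_edge xy xs)) big_cons ler_wpM2l // IHs.
Qed.

Lemma prod_cycle_le (u : seq 'I_n) :
  \prod_(o <- undup (edges (cycle_steps u))) w o <= first_visits u.
Proof.
case: u => [|x s]; first by rewrite big_nil.
apply: le_trans (prod_steps_le x s); rewrite [edges _]/= [undup _]/=.
by case: ifP => // _; rewrite big_cons ler_piMl // prod_edges_ge0.
Qed.

End FirstVisits.

(** Each first visit after the start brings a new edge: in a connected graph the vertices exceed the
    edges by at most 1. *)
Lemma fresh_steps (n : nat) (x : 'I_n) (s : seq 'I_n) :
  (fresh (pattern (x :: s)) <= (size (undup (edges (steps x s)))).+1)%N.
Proof.
elim: s x => [|y s IHs] x //; rewrite fresh_pattern.
have := IHs y; rewrite fresh_pattern.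
rewrite [undup (x :: _)]/= [edges (steps x _)]/= [undup (oedge _ _ :: _)]/=.
have [xs|xs] := boolP (x \in y :: s).
  by move=> /leq_trans-> //; case: ifP.
have xy : x != y by apply: contraNneq xs => ->; rewrite mem_head.
by rewrite (negbTE (new_vertex_edge xy xs)).
Qed.

Lemma fresh_repeated (n p : nat) (u : seq 'I_n) :
  (size u <= 2 * p)%N -> repeated (edges (cycle_steps u)) ->
  (fresh (pattern u) <= p.+1)%N.
Proof.
case: u => // x s su /repeated_undup.
rewrite [X in (_ <= X)%N]size_map size_cycle_steps => su2.
apply: leq_trans (fresh_steps x s) _; rewrite ltnS.
have : (size (undup (edges (steps x s))) <=
        size (undup (edges (cycle_steps (x :: s)))))%N.
  by rewrite [edges (cycle_steps _)]/= [undup (_ :: _)]/=; case: ifP.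
by move=> /leq_trans-> //; rewrite -(leq_pmul2l (ltn0Sn 1)) (leq_trans su2).
Qed.

Section PatternSums.
Variables (R : numDomainType) (n : nat) (w : option (vpair n) -> R) (d : R).
Hypotheses (w0 : forall o, 0 <= w o) (d0 : 0 <= d).
Hypothesis (wd : forall y, \sum_x w (oedge x y) <= d).

(** Vertices are prepended one at a time: a revisit is dictated by the pattern, a first visit costs
    at most [d] by [wd]. The starting vertex has [n] choices yet is counted in [fresh c]; the factor
    [d] on the left compensates without an exponent [fresh c - 1]. *)
Lemma sum_first_visits (L : nat) (c : seq nat) :
  d * \sum_(u <- words 'I_n L.+1 | pattern u == c) first_visits w u
    <= n%:R * d ^+ fresh c.
Proof.
have fv := first_visits_ge0 w0.
elim: L c => [|L IHL] c.
  rewrite big_mkcond big_wordsS.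
  under eq_bigr do rewrite big_words0 /=.
  case: (eqVneq [:: 0%N] c) => [<-|_].
    by rewrite /= !mulr1 sumr_const card_ord mulrC.
  by rewrite big1 // mulr0 mulr_ge0 ?exprn_ge0.
case: c => [|a c].
  rewrite big_seq_cond big1 ?mulr0 ?mulr_ge0 ?exprn_ge0 //.
  by move=> u /andP[/size_words]; case: u.
rewrite big_mkcond big_wordsS exchange_big /=.
apply: (@le_trans _ _ (d * \sum_(u <- words 'I_n L.+1 | pattern u == c)
    first_visits w u * (if a == size c then d else 1))).
  rewrite ler_wpM2l // [leRHS]big_mkcond big_seq [leRHS]big_seq.
  apply: ler_sum => u /size_words; case: u => // y s _.
  case: (eqVneq (pattern (y :: s)) c) => [<-|neq]; last first.
    rewrite big1 // => x _; case: eqP => // -[_ E].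
    by move: neq; rewrite -E eqxx.
  pose g x := if index x (y :: s) == a then
     if x \in y :: s then 1 else w (oedge x y) else 0.
  rewrite (eq_bigr (fun x => first_visits w (y :: s) * g x)); last first.
    move=> x _; rewrite eqseq_cons eqxx andbT /g.
    by case: ifP => _; rewrite ?mulr0 // mulrC.
  rewrite -mulr_sumr ler_wpM2l // size_pattern /g.
  case: ifP => [/eqP->|na].
    apply: le_trans (wd y); apply: ler_sum => x _.
    have [xs|xs] := boolP (x \in y :: s); last by case: ifP.
    by rewrite ltn_eqF ?index_mem.
  apply: (@le_trans _ _ (\sum_(x | x == nth y (y :: s) a) 1)).
    rewrite [leRHS]big_mkcond; apply: ler_sum => x _.
    case: (eqVneq _ a) => [E|]; last by case: ifP.
    have [xs|xs] := boolP (x \in y :: s); last first.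
      by move: na; rewrite -E -index_mem in xs *; move: xs; rewrite -leqNgt => xs;
         rewrite eqn_leq index_size xs.
    by rewrite -E nth_index ?eqxx.
  by rewrite big_pred1_eq.
rewrite -mulr_suml mulrA [fresh _]/= exprD mulrCA [leRHS]mulrC.
by case: eqP => _; rewrite ?expr1 ?expr0 ler_wpM2r // IHL.
Qed.

End PatternSums.

Lemma index_map_in (T U : eqType) (f : T -> U) (x : T) (s : seq T) :
  {in x :: s &, injective f} -> index (f x) (map f s) = index x s.
Proof.
elim: s => //= y s IHs fI; rewrite (inj_in_eq fI) ?inE ?eqxx ?orbT //.
case: ifP => // _; rewrite IHs // => a b ain bin; apply: fI.
  by move: ain; rewrite !inE => /orP[]->; rewrite ?orbT.
by move: bin; rewrite !inE => /orP[]->; rewrite ?orbT.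
Qed.

(** A revisit keeps its label; before a first visit at most [p] of the [2 * p] labels are taken, so
    at least [p] remain. *)
Lemma pattern_count (R : numDomainType) (n p : nat) (u : seq 'I_n) :
  (0 < size u)%N -> (fresh (pattern u) <= p.+1)%N ->
  (2 * p)%:R * p%:R ^+ fresh (pattern u) <= p%:R *
    \sum_(v <- words 'I_(2 * p) (size u) | pattern v == pattern u) 1 :> R.
Proof.
case: u => // x s _; elim: s x => [|y s IHs] x fu.
  rewrite big_mkcond big_wordsS.
  rewrite (eq_bigr (fun=> 1)) => [|y _]; last by rewrite big_words0.
  by rewrite sumr_const card_ord /= expr1 mulrC.
have freshS : fresh (pattern [:: x, y & s]) =
    ((index x (y :: s) == size (y :: s)) + fresh (pattern (y :: s)))%N.
  by rewrite -(size_pattern (y :: s)).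
have fy : (fresh (pattern (y :: s)) <= p.+1)%N.
  by apply: leq_trans fu; rewrite freshS leq_addl.
rewrite [size _]/= [X in _ <= _ * X]big_mkcond big_wordsS exchange_big.
set f := if x \in y :: s then 1 else p%:R : R.
apply: (@le_trans _ _ (p%:R * \sum_(v <- words 'I_(2 * p) (size s).+1
            | pattern v == pattern (y :: s)) f)); last first.
  rewrite ler_wpM2l // [leLHS]big_mkcond big_seq [leRHS]big_seq.
  apply: ler_sum => v /size_words; case: v => // y' t _.
  case: eqP => [E|_]; last by rewrite sumr_ge0 // => x' _; case: ifP.
  rewrite (eq_bigr (fun x' => if index x' (y' :: t) == index x (y :: s)
                              then 1 else 0)); last first.
    by move=> x' _; rewrite [pattern (x' :: _)]/= [pattern (x :: _)]/=
       eqseq_cons; move: E => /= ->; rewrite eqxx andbT.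
  have [g gI gE] := pattern_relabel E.
  rewrite -big_mkcond /f; case: ifP => xs.
    rewrite (bigD1 (g x)); last first.
      rewrite gE index_map_in // => a b.
      by rewrite !inE => ain bin; apply: gI;
         [move: ain|move: bin]; rewrite !inE => /orP[/eqP->|//]; rewrite -in_cons.
    by rewrite lerDl sumr_ge0.
  have ix : index x (y :: s) = size (y' :: t).
    by rewrite gE size_map; apply: memNindex; rewrite xs.
  rewrite ix (eq_bigl (fun x' => x' \notin undup (y' :: t))); last first.
    move=> x'; rewrite mem_undup -index_mem -leqNgt eqn_leq index_size //.
  rewrite sumr_const ler_nat.
  have /card_uniqP cu := undup_uniq (y' :: t).
  have := cardC (mem (undup (y' :: t))); rewrite cu card_ord -fresh_pattern E => cC.
  rewrite (eq_card (B := predC (mem (undup (y' :: t))))) //.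
  (* [x] is itself fresh, so the tail has at most [p] of the [p + 1] allowed vertices. *)
  have fp : (fresh (pattern (y :: s)) <= p)%N.
    by move: fu; rewrite freshS ix gE size_map eqxx.
  by rewrite -(leq_add2l (fresh (pattern (y :: s)))) cC mul2n -addnn leq_add2r.
rewrite -[f]mulr1 -mulr_sumr mulrCA.
rewrite freshS exprD mulrCA.
have -> : p%:R ^+ (index x (y :: s) == size (y :: s)) = f.
  rewrite /f -index_mem; case: ltngtP (index_size x (y :: s)) => //.
rewrite [leLHS]mulrCA [leRHS]mulrCA ler_wpM2l ?IHs //.
by rewrite /f; case: ifP.
Qed.

Lemma repeated_pattern (m n : nat) (u : seq 'I_m) (v : seq 'I_n) :
  pattern u = pattern v ->
  repeated (edges (cycle_steps u)) = repeated (edges (cycle_steps v)).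
Proof.
case: u v => [|x s] [|y t] // /pattern_relabel[f fI ->].
exact: repeated_relabel.
Qed.

Section WalkComparison.
Variables (R : numFieldType) (n p : nat) (w : option (vpair n) -> R).
Hypotheses (p0 : (0 < p)%N) (w0 : forall o, 0 <= w o) (w1 : forall o, w o <= 1).
Hypothesis (wp : forall y, \sum_x w (oedge x y) <= p%:R).

(* Both sides are sorted by the pattern of the walk.  A pattern with l
   vertices has at most p ^ (l - 1) weighted realizations from each starting
   point in 'I_n, and at least p ^ (l - 1) of them in 'I_(2 * p), because
   repeated edges force l <= p + 1. *)
Lemma walk_comparison :
  \sum_(u <- words 'I_n (2 * p) | repeated (edges (cycle_steps u)))
     \prod_(o <- undup (edges (cycle_steps u))) w o
  <= n%:R / (2 * p)%:R *
  \sum_(v <- words 'I_(2 * p) (2 * p)) (repeated (edges (cycle_steps v)))%:R.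
Proof.
have fv := first_visits_ge0 w0.
have P0 : 0 < p%:R :> R by rewrite ltr0n.
have r0 : 0 < (2 * p)%:R :> R by rewrite ltr0n muln_gt0.
pose rep m (u : seq 'I_m) := repeated (edges (cycle_steps u)).
pose F (u : seq 'I_n) := first_visits w u / p%:R ^+ fresh (pattern u).
have F0 u : 0 <= F u by rewrite divr_ge0 ?exprn_ge0 // ltW.
(* The weight of each [u] is spread over the [v] of the same pattern; after exchanging the sums,
   [sum_first_visits] bounds what a fixed [v] receives. *)
apply: (@le_trans _ _ (\sum_(u <- words 'I_n (2 * p)) \sum_(v <- words 'I_(2 * p) (2 * p))
    (if pattern v == pattern u then p%:R / (2 * p)%:R * F u * (rep _ v)%:R else 0))).
  rewrite big_mkcond big_seq [leRHS]big_seq; apply: ler_sum => u /size_words su.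
  case: ifP => ru; last first.
    by rewrite sumr_ge0 // => v _; case: ifP => // _;
       rewrite ?mulr_ge0 ?invr_ge0 ?fv ?exprn_ge0 ?ler0n.
  apply: le_trans (prod_cycle_le w0 w1 u) _.
  have fu : (fresh (pattern u) <= p.+1)%N by apply: fresh_repeated ru; rewrite su.
  have u0 : (0 < size u)%N by rewrite su muln_gt0.
  have := pattern_count R u0 fu; rewrite su.
  set S := \sum_(v <- _ | _) 1; set q := p%:R ^+ _ => H.
  rewrite (eq_bigr (fun v => p%:R / (2 * p)%:R * F u *
      (if pattern v == pattern u then 1 else 0))); last first.
    move=> v _; case: eqP => [E|_]; last by rewrite mulr0.
    by rewrite /rep (repeated_pattern E) ru.
  rewrite -mulr_sumr -big_mkcond /F -/S -/q.
  have q0 : 0 < q by rewrite exprn_gt0.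
  have -> : p%:R / (2 * p)%:R * (first_visits w u / q) * S =
      first_visits w u * (p%:R * S / ((2 * p)%:R * q)).
    by field; rewrite !lt0r_neq0.
  by rewrite ler_peMr // ler_pdivlMr ?mulr_gt0 // mul1r.
rewrite exchange_big mulr_sumr; apply: ler_sum => v _.
apply: (@le_trans _ _ ((rep _ v)%:R * ((2 * p)%:R)^-1 / p%:R ^+ fresh (pattern v) *
    (p%:R * \sum_(u <- words 'I_n (2 * p) | pattern u == pattern v) first_visits w u))).
  rewrite !mulr_sumr [leRHS]big_mkcond; apply: ler_sum => u _.
  rewrite eq_sym; case: eqP => // E.
  by rewrite /F E le_eqVlt; apply/orP; left; apply/eqP; ring.
have pv0 : 0 < p%:R ^+ fresh (pattern v) :> R by rewrite exprn_gt0.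
have /(ler_wpM2l (ltW _)) := sum_first_visits w0 (ltW P0) wp (2 * p).-1 (pattern v).
rewrite prednK ?muln_gt0 // => /(_ _ (divr_gt0 (divr_gt0 ltr01 r0) pv0)) H.
rewrite /rep; case: (repeated _); last by rewrite !mul0r mulr0.
rewrite (_ : true%:R = 1 :> R) // mulr1; apply: le_trans H _.
by rewrite mul1r mulrCA mulfVK // gt_eqF.
Qed.
End WalkComparison.

(** * Traces and operator norm bounds *)

Definition graph_mx (R : pzRingType) (n : nat) (f : vpair n -> R) : 'M[R]_n :=
  \matrix_(i, j) oapp f 0 (oedge i j).

Lemma graph_mx_tr (R : pzRingType) (n : nat) (f : vpair n -> R) :
  (graph_mx f)^T = graph_mx f.
Proof. by apply/matrixP => i j; rewrite !mxE oedgeC. Qed.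

(** [g] weighs the endpoint of an open walk; taking column [x] of [X] for it closes the walk, which
    yields the trace. *)
Lemma mulmx_walks (R : pzRingType) (n L : nat) (X : 'M[R]_n) (x : 'I_n) (g : 'I_n -> R) :
  \sum_y (X ^+ L) x y * g y =
  \sum_(s <- words 'I_n L) (\prod_(e <- steps x s) X e.1 e.2) * g (last x s).
Proof.
elim: L x => [|L IHL] x.
  rewrite big_words0 /= big_nil mul1r expr0 (bigD1 x) //= mxE eqxx mul1r.
  by rewrite big1 ?addr0 // => y; rewrite mxE eq_sym => /negbTE->; rewrite mul0r.
rewrite big_wordsS.
under [RHS]eq_bigr => y _.
  under eq_bigr => s _ do rewrite /= big_cons /= -mulrA.
  rewrite -mulr_sumr -IHL mulr_sumr.
  over.
rewrite exchange_big /=; apply: eq_bigr => y _.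
by rewrite exprS mxE mulr_suml; apply: eq_bigr => z _; rewrite mulrA.
Qed.

Lemma tr_cycles (R : comPzRingType) (n L : nat) (f : vpair n -> R) :
  (0 < L)%N ->
  \tr (graph_mx f ^+ L) =
  \sum_(u <- words 'I_n L) \prod_(o <- edges (cycle_steps u)) oapp f 0 o.
Proof.
case: L => // L _; rewrite big_wordsS; apply: eq_bigr => x _.
rewrite exprSr mxE mulmx_walks; apply: eq_bigr => s _.
rewrite [edges _]/= big_cons mulrC mxE; congr (_ * _).
by rewrite big_map; apply: eq_bigr => e _; rewrite mxE.
Qed.

Section OperatorBound.
Variables (R : rcfType) (n : nat).
Implicit Types (X Z : 'M[R]_n) (x y : 'cV[R]_n).

Definition dotv x y : R := \sum_i x i 0 * y i 0.

Lemma dotvE x y : (x^T *m y) 0 0 = dotv x y.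
Proof. by rewrite mxE; apply: eq_bigr => i _; rewrite mxE. Qed.

Lemma dotv_ge0 x : 0 <= dotv x x.
Proof. by apply: sumr_ge0 => i _; rewrite -expr2 sqr_ge0. Qed.

Lemma dotvC x y : dotv x y = dotv y x.
Proof. by apply: eq_bigr => i _; rewrite mulrC. Qed.

Lemma dotvDl x y z : dotv (x + y) z = dotv x z + dotv y z.
Proof. by rewrite /dotv -big_split; apply: eq_bigr => i _; rewrite mxE mulrDl. Qed.

Lemma dotvZl a x y : dotv (a *: x) y = a * dotv x y.
Proof. by rewrite /dotv mulr_sumr; apply: eq_bigr => i _; rewrite mxE mulrA. Qed.

Lemma dotv_eq0 x : dotv x x = 0 -> x = 0.
Proof.
move=> /eqP; rewrite psumr_eq0 => [|i _]; last by rewrite -expr2 sqr_ge0.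
move=> /allP x0; apply/matrixP => i j; rewrite ord1 mxE.
by have := x0 i (mem_index_enum i); rewrite /= mulf_eq0 orbb => /eqP.
Qed.

Lemma dotv_CS x y : dotv x y ^+ 2 <= dotv x x * dotv y y.
Proof.
have [y0|y0] := eqVneq (dotv y y) 0.
  rewrite y0 (dotv_eq0 y0) mulr0 /dotv big1 ?expr0n // => i _.
  by rewrite mxE mulr0.
have yp : 0 < dotv y y by rewrite lt_def y0 dotv_ge0.
have := dotv_ge0 (dotv y y *: x + (- dotv x y) *: y).
rewrite !dotvDl !dotvZl ![dotv _ (_ + _)]dotvC !dotvDl !dotvZl [dotv y x]dotvC.
set a := dotv x x; set b := dotv x y; set c := dotv y y in yp *.
have -> : c * (c * a + - b * b) + - b * (c * b + - b * c) = c * (a * c - b ^+ 2) by ring.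
by rewrite pmulr_rge0 // subr_ge0.
Qed.

Definition opbound X (b : R) := forall x, dotv (X *m x) (X *m x) <= b ^+ 2 * dotv x x.

Lemma dotv_sym X x y : X^T = X -> dotv (X *m x) y = dotv x (X *m y).
Proof. by move=> XT; rewrite -!dotvE trmx_mul XT mulmxA. Qed.

Lemma opbound_quad X b x : 0 <= b -> opbound X b -> dotv x (X *m x) <= b * dotv x x.
Proof.
move=> b0 Xb; have x0 := dotv_ge0 x.
have [h|xX] := leP (dotv x (X *m x)) 0; first by rewrite (le_trans h) ?mulr_ge0.
rewrite -(@ler_pXn2r _ 2) ?nnegrE ?mulr_ge0 ?(ltW xX) //.
apply: le_trans (dotv_CS _ _) _.
by rewrite exprMn expr2 [leRHS]mulrC -mulrA ler_wpM2l // mulrC.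
Qed.

(** Symmetry turns the squared norm of [X *m x] into [dotv x (X *m X *m x)], to which Cauchy-Schwarz
    applies. *)
Lemma opbound_sqr X b : X^T = X -> 0 <= b -> opbound (X *m X) (b ^+ 2) -> opbound X b.
Proof.
move=> XT b0 Xb x; have x0 := dotv_ge0 x.
rewrite -(@ler_pXn2r _ 2) ?nnegrE ?mulr_ge0 ?exprn_ge0 ?dotv_ge0 //.
rewrite dotv_sym // mulmxA; apply: le_trans (dotv_CS _ _) _.
by rewrite exprMn [dotv x x ^+ 2]expr2 [leRHS]mulrCA ler_wpM2l.
Qed.

Lemma opbound_mul X Z b c :
  0 <= b -> opbound X b -> opbound Z c -> opbound (X *m Z) (b * c).
Proof.
move=> b0 Xb Zc x; rewrite -mulmxA; apply: le_trans (Xb _) _.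
by rewrite exprMn -[leRHS]mulrA ler_wpM2l ?exprn_ge0.
Qed.

Lemma opbound_expr X b k : 0 <= b -> opbound X b -> opbound (X ^+ k) (b ^+ k).
Proof.
move=> b0 Xb; elim: k => [|k IHk].
  by move=> x; rewrite !expr0 mul1mx expr1n mul1r.
by rewrite !exprS; apply: opbound_mul.
Qed.

Lemma tr_exprn_sym X k : X^T = X -> (X ^+ k)^T = X ^+ k.
Proof.
move=> XT; elim: k => [|k IHk]; first by rewrite expr0 trmx1.
by rewrite {1}exprSr trmx_mul IHk XT exprS.
Qed.

Lemma tr_sqr X : X^T = X -> \tr (X *m X) = \sum_i \sum_j X i j ^+ 2.
Proof.
move=> XT; apply: eq_bigr => i _; rewrite mxE; apply: eq_bigr => j _.
by rewrite -{2}XT mxE expr2.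
Qed.

(** The trace is the squared Frobenius norm, which dominates the operator norm by Cauchy-Schwarz on
    each row. *)
Lemma opbound_tr X b : X^T = X -> \tr (X *m X) <= b ^+ 2 -> opbound X b.
Proof.
move=> XT Xb x; apply: le_trans (ler_wpM2r (dotv_ge0 x) Xb).
rewrite tr_sqr // mulr_suml; apply: ler_sum => i _.
have -> : \sum_j X i j ^+ 2 = dotv (row i X)^T (row i X)^T.
  by apply: eq_bigr => j _; rewrite !mxE expr2.
apply: le_trans (dotv_CS _ _); rewrite -expr2 le_eqVlt; apply/orP; left.
by apply/eqP; congr (_ ^+ 2); rewrite mxE; apply: eq_bigr => j _; rewrite !mxE.
Qed.

Lemma tr_expr_ge0 X k : X^T = X -> 0 <= \tr (X ^+ (k * 2)).
Proof.
move=> XT; rewrite exprM expr2 tr_sqr ?tr_exprn_sym //.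
by apply: sumr_ge0 => i _; apply: sumr_ge0 => j _; rewrite sqr_ge0.
Qed.

(** The Frobenius bound handles [X ^+ (2 ^ a)]; then [opbound_sqr] halves the exponent [a] times. *)
Lemma opbound_tr_expr X b a : X^T = X -> 0 <= b ->
  \tr (X ^+ (2 ^ a.+1)) <= b ^+ (2 ^ a.+1) -> opbound X b.
Proof.
move=> XT b0 trX; have : opbound (X ^+ (2 ^ a)) (b ^+ (2 ^ a)).
  apply: opbound_tr; first exact: tr_exprn_sym.
  by rewrite -[X in \tr X](expr2 (X ^+ (2 ^ a))) -!exprM -expnSr.
elim: a {trX} => [|a IHa]; first by rewrite !expr1.
by rewrite expnSr !exprM !expr2 => Xb; apply/IHa/opbound_sqr;
   rewrite ?tr_exprn_sym ?exprn_ge0.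
Qed.

(** The trace of an even power sums the squared norms of the columns of [X ^+ k], which are images
    of unit vectors. *)
Lemma tr_expr_le X b k : X^T = X -> 0 <= b -> opbound X b ->
  \tr (X ^+ (k * 2)) <= n%:R * b ^+ (k * 2).
Proof.
move=> XT b0 Xb; have := opbound_expr k b0 Xb; have := tr_exprn_sym k XT.
rewrite !exprM; set Z := X ^+ k; set c := b ^+ k => ZT Zc.
rewrite expr2 tr_sqr // mulr_natl -[n in leRHS]card_ord -sumr_const.
apply: ler_sum => i _; have := Zc (delta_mx i 0).
have -> : dotv (delta_mx i 0) (delta_mx i 0) = 1.
  rewrite /dotv (bigD1 i) //= mxE !eqxx mulr1 big1 ?addr0 // => j ji.
  by rewrite mxE (negbTE ji) mul0r.
rewrite mulr1; apply: le_trans; rewrite -colE.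
by apply: ler_sum => j _; rewrite -{1}ZT !mxE -expr2.
Qed.

End OperatorBound.

(** * Moments of the comparison matrix *)

Section Exponential.
Variable R : realType.
Implicit Types x t : R.

(** The linear term cancels on averaging over a centered variable, which leaves a subgaussian
    bound. *)
Lemma expR_le_quad x : expR x <= x + expR (2 * x ^+ 2).
Proof.
have x2 : 0 <= x ^+ 2 by rewrite sqr_ge0.
have := expR_ge1Dx (2 * x ^+ 2).
have [x1|x1] := leP x 1; last first.
  move=> _; have : expR x <= expR (2 * x ^+ 2) by rewrite ler_expR; nra.
  by nra.
move=> H; suff : expR x <= 1 + x + 2 * x ^+ 2 by lra.
(* For [x <= 1] this bounds [expR x] by the inverse of [(1 - x / 2) ^+ 2], and the claim becomes
   polynomial. *)
have h : 1 - x / 2 <= expR (- (x / 2)) by rewrite expR_ge1Dx.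
have h2 : (1 - x / 2) ^+ 2 <= expR (- x).
  have -> : - x = - (x / 2) + - (x / 2) by lra.
  by rewrite expRD expr2; apply: ler_pM => //; lra.
have e0 := expR_gt0 x; have e1 : expR x * expR (- x) = 1 by rewrite expRxMexpNx_1.
have q0 : 0 < (1 - x / 2) ^+ 2 by rewrite exprn_gt0 //; lra.
have le1 : expR x * (1 - x / 2) ^+ 2 <= 1 by move: h2; rewrite -(ler_pM2l e0) e1.
rewrite -(ler_pM2r q0) (le_trans le1) //.
have -> : (1 + x + 2 * x ^+ 2) * (1 - x / 2) ^+ 2 =
   1 + x ^+ 2 * ((1 - x) * (5 / 2 - x)) / 2 by field.
by rewrite lerDl divr_ge0 // mulr_ge0 // mulr_ge0 //; lra.
Qed.

(** Raise [|x| / r <= expR (|x| / r)] to the power [r]; evenness allows passing to [|x|]. *)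
Lemma exprn_le_expR x (r : nat) : ~~ odd r -> (0 < r)%N ->
  x ^+ r <= r%:R ^+ r * (expR x + expR (- x)).
Proof.
move=> r_even r0; have R0 : 0 < r%:R :> R by rewrite ltr0n.
apply: (@le_trans _ _ (r%:R ^+ r * expR `|x|)).
  have -> : x ^+ r = r%:R ^+ r * (`|x| / r%:R) ^+ r.
    rewrite expr_div_n mulrC divfK ?expf_neq0 ?gt_eqF // -normrX ger0_norm //.
    exact: exprn_even_ge0.
  rewrite ler_wpM2l ?exprn_ge0 //.
  have -> : `|x| = r%:R * (`|x| / r%:R) by rewrite mulrC divfK ?gt_eqF.
  rewrite expRM_natl [X in X / _](_ : _ = `|x|); last by rewrite mulrC divfK ?gt_eqF.
  rewrite lerXn2r ?nnegrE ?expR_ge0 ?divr_ge0 //.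
  by apply: le_trans (expR_ge1Dx _); rewrite lerDr.
rewrite ler_wpM2l ?exprn_ge0 //.
by case: (ger0P x) => _; rewrite ?lerDl ?lerDr expR_ge0.
Qed.

End Exponential.

(** * Symmetric matrices with independent bounded entries *)

Section SignMatrix.
Variables (R : realType) (r : nat).

Definition coin := 'I_3.
(* A bounded centered variable all of whose moments of order at least 2 are
   at least 1, odd orders included; fair signs would require the graph
   entries to be symmetrized first. *)
Definition coin_val (o : coin) : R := if o == ord0 then 2 else -1.

Definition coin_mean (g : coin -> R) : R := 3^-1 * \sum_o g o.

Definition sample := {ffun vpair r -> coin}.
Definition sample_val (f : sample) (e : vpair r) : R := coin_val (f e).

Definition sample_mean (F : sample -> R) : R :=
  \sum_(f : sample) (\prod_(e : vpair r) 3^-1) * F f.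

Lemma coin_meanE (g : R -> R) :
  coin_mean (fun o => g (coin_val o)) = (g 2 + 2 * g (-1)) / 3.
Proof.
rewrite /coin_mean !big_ord_recl big_ord0 /coin_val /=; lra.
Qed.

Lemma sample_mean_prod (g : vpair r -> R -> R) :
  sample_mean (fun f => \prod_e g e (sample_val f e)) =
  \prod_e coin_mean (fun o => g e (coin_val o)).
Proof.
rewrite /coin_mean; under [RHS]eq_bigr do rewrite mulr_sumr.
rewrite bigA_distr_bigA; apply: eq_bigr => f _.
by rewrite [RHS]big_split.
Qed.

Lemma sample_mean_le (F G : sample -> R) :
  (forall f, F f <= G f) -> sample_mean F <= sample_mean G.
Proof.
move=> FG; apply: ler_sum => f _; rewrite ler_wpM2l //.
by apply: prodr_ge0 => e _; rewrite invr_ge0 ler0n.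
Qed.

Lemma sample_meanZ (a : R) (F : sample -> R) :
  sample_mean (fun f => a * F f) = a * sample_mean F.
Proof. by rewrite /sample_mean mulr_sumr; apply: eq_bigr => f _; rewrite mulrCA. Qed.

Lemma sample_meanD (F G : sample -> R) :
  sample_mean (fun f => F f + G f) = sample_mean F + sample_mean G.
Proof.
by rewrite /sample_mean -big_split; apply: eq_bigr => f _; rewrite mulrDr.
Qed.

Lemma sample_mean_sum (I : Type) (l : seq I) (P : pred I) (F : I -> sample -> R) :
  sample_mean (fun f => \sum_(i <- l | P i) F i f) =
  \sum_(i <- l | P i) sample_mean (F i).
Proof.
rewrite /sample_mean exchange_big; apply: eq_bigr => f _.
by rewrite mulr_sumr.
Qed.

(** [expR_le_quad] is used at [2 * t] and [- t], where the weights 1/3 and 2/3 cancel the linear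
    terms; 8 is [2 * 2 ^ 2]. *)
Lemma coin_mgf (t : R) : coin_mean (fun o => expR (t * coin_val o)) <= expR (8 * t ^+ 2).
Proof.
rewrite (coin_meanE (fun y => expR (t * y))).
have h1 := expR_le_quad (t * 2); have h2 := expR_le_quad (t * -1).
have e1 : 2 * (t * 2) ^+ 2 = 8 * t ^+ 2 by ring.
have h3 : expR (2 * (t * -1) ^+ 2) <= expR (8 * t ^+ 2).
  by rewrite ler_expR; have := sqr_ge0 t; nra.
rewrite e1 in h1; lra.
Qed.

Lemma sample_mgf (a : vpair r -> R) :
  sample_mean (fun f => expR (\sum_e a e * sample_val f e))
    <= expR (8 * \sum_e a e ^+ 2).
Proof.
have -> : sample_mean (fun f => expR (\sum_e a e * sample_val f e)) =
    \prod_e coin_mean (fun o => expR (a e * coin_val o)).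
  rewrite -(sample_mean_prod (fun e y => expR (a e * y))).
  by apply: eq_bigr => f _; rewrite expR_sum.
rewrite mulr_sumr expR_sum; apply: ler_prod => e _; rewrite coin_mgf andbT.
by rewrite mulr_ge0 ?invr_ge0 ?ler0n ?sumr_ge0 // => o _; rewrite expR_ge0.
Qed.

(** This makes the bilinear form linear in the independent entries, as [sample_mgf] requires. *)
Lemma quad_graph (f : vpair r -> R) (x y : 'cV[R]_r) :
  dotv x (graph_mx f *m y) =
  \sum_(e : vpair r) (x (val e).1 0 * y (val e).2 0
                    + x (val e).2 0 * y (val e).1 0) * f e.
Proof.
transitivity (\sum_i \sum_j \sum_(e : vpair r)
    (if oedge i j == Some e then x i 0 * y j 0 * f e else 0)).
  apply: eq_bigr => i _; rewrite mxE mulr_sumr; apply: eq_bigr => j _.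
  rewrite mxE; case: (oedge i j) => [e|] /=; last by rewrite mul0r mulr0 big1.
  rewrite (bigD1 e) //= eqxx big1 ?addr0 => [|e' /negbTE].
    by rewrite mulrA mulrAC.
  by rewrite eq_sym => ee'; case: eqP => // -[E]; rewrite E eqxx in ee'.
rewrite pair_big exchange_big; apply: eq_bigr => e _ /=.
have ne : (sval e).1 != (sval e).2.
  by apply: contraTneq (valP e) => /= ->; rewrite ltnn.
have vE : val e = ((sval e).1, (sval e).2) by rewrite -surjective_pairing.
move: vE ne; set a := (sval e).1; set b := (sval e).2 => vE ab.
rewrite (bigD1 (a, b)) //= oedgeP vE eqxx /=.
rewrite (bigD1 (b, a)) /=; last by rewrite xpair_eqE negb_and eq_sym ab.
rewrite oedgeP vE eqxx orbT big1 ?addr0 ?mulrDl // => -[i j] /= /andP[n1 n2].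
rewrite oedgeP vE eq_sym (negbTE n1) /= xpair_eqE andbC [b == i]eq_sym [a == j]eq_sym.
by rewrite xpair_eqE in n2; rewrite (negbTE n2).
Qed.

Lemma sum_edge_weights (x y : 'cV[R]_r) :
  \sum_(e : vpair r) (x (val e).1 0 * y (val e).2 0
                    + x (val e).2 0 * y (val e).1 0) ^+ 2
    <= 2 * (dotv x x * dotv y y).
Proof.
pose sq (v : 'cV[R]_r) : 'cV[R]_r := \col_i v i 0 ^+ 2.
apply: (@le_trans _ _ (2 * dotv (sq x) (graph_mx (fun=> 1) *m sq y))).
  rewrite quad_graph mulr_sumr; apply: ler_sum => e _; rewrite !mxE mulr1.
  set a := x _ _; set b := y _ _; set c := x _ _; set d := y _ _.
  have := sqr_ge0 (a * b - c * d); nra.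
rewrite ler_wpM2l // /dotv mulr_suml; apply: ler_sum => i _.
rewrite !mxE -expr2 ler_wpM2l ?sqr_ge0 //; apply: ler_sum => j _.
rewrite !mxE -expr2; case: (oedge i j) => [e|] /=; first by rewrite mul1r.
by rewrite mul0r sqr_ge0.
Qed.

End SignMatrix.

(** * An integer net for the ball of squared radius r *)

Section Net.
Variables (R : realType) (r : nat).

(* Integer vectors, stored as signs and absolute values; 0 occurs twice. *)
Definition lattice := {ffun 'I_r -> bool * 'I_(4 * r).+1}.

Definition lattice_vec (z : lattice) : 'cV[R]_r :=
  \col_i ((-1) ^+ (z i).1 * (z i).2%:R).

Definition lattice_net : {set lattice} :=
  [set z : lattice | (\sum_i (z i).2 ^ 2 <= 4 * r)%N].

Lemma lattice_net_norm (z : lattice) :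
  z \in lattice_net -> dotv (lattice_vec z) (lattice_vec z) <= 4 * r%:R.
Proof.
rewrite inE -(ler_nat R) natrM natr_sum; apply: le_trans.
apply: ler_sum => i _; rewrite mxE -expr2 exprMn sqrr_sign mul1r.
by rewrite natrX.
Qed.

(** Chernoff counting: a net point has weight [2 ^ (- sum of squares)] at least [16 ^ (- r)], while
    the total weight of the lattice factors over coordinates, each giving at most 4 (two signs, and
    a series at most 2). *)
Lemma card_lattice_net : #|lattice_net|%:R <= 64 ^+ r :> R.
Proof.
have half2 (N : nat) : \sum_(k < N) (2^-1 : R) ^+ k <= 2.
  have -> : \sum_(k < N) (2^-1 : R) ^+ k = 2 - 2 * 2^-1 ^+ N.
    elim: N => [|N IHN]; first by rewrite big_ord0 expr0; ring.
    by rewrite big_ord_recr IHN exprS /=; field.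
  by rewrite gerBl mulr_ge0 // exprn_ge0 // invr_ge0.
rewrite -sum1_card natr_sum.
apply: (@le_trans _ _ (\sum_(z : lattice) 16 ^+ r * \prod_i 2^-1 ^+ ((z i).2 ^ 2))).
  rewrite big_mkcond; apply: ler_sum => z _.
  case: ifP => [|_]; last first.
    by rewrite mulr_ge0 ?exprn_ge0 // prodr_ge0 // => i _; rewrite exprn_ge0 ?invr_ge0.
  rewrite inE => zr; rewrite prodrXr exprVn.
  rewrite ler_pdivlMr ?exprn_gt0 // mul1r.
  have -> : 16 = 2 ^+ 4 :> R by ring.
  by rewrite -exprM ler_weXn2l // ler1n.
rewrite -mulr_sumr.
rewrite -(bigA_distr_bigA (fun i (a : bool * 'I_(4 * r).+1) => 2^-1 ^+ (a.2 ^ 2))).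
have -> : 64 = 16 * 4 :> R by ring.
rewrite exprMn ler_wpM2l ?exprn_ge0 // -[r in leRHS]card_ord -prodr_const.
apply: ler_prod => i _; rewrite sumr_ge0 => [|a _]; last by rewrite exprn_ge0 ?invr_ge0.
rewrite -(pair_bigA _ (fun (_ : bool) (k : 'I_(4 * r).+1) => (2^-1 : R) ^+ (k ^ 2))) /=.
rewrite big_bool /=.
have : \sum_(k < (4 * r).+1) (2^-1 : R) ^+ (k ^ 2) <= 2; last by lra.
apply: le_trans (half2 (4 * r).+1); apply: ler_sum => k _.
by rewrite ler_wiXn2l ?invr_ge0 // ?invf_le1 ?ler1n //; nia.
Qed.

(** Each coordinate moves away from 0 to an integer when its term [c i * x i 0] is positive, and to
    0 otherwise, so no term decreases and there is no approximation error. The radius comes from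
    [(|x i| + 1) ^ 2 <= 2 * |x i| ^ 2 + 2]. *)
Lemma lattice_round (c : 'I_r -> R) (x : 'cV[R]_r) : dotv x x <= r%:R ->
  exists2 z, z \in lattice_net &
    \sum_i c i * x i 0 <= \sum_i c i * lattice_vec z i 0.
Proof.
move=> xr.
pose k i : nat := if 0 < c i * x i 0 then (Num.truncn `|x i 0|).+1 else 0%N.
have ksq : (\sum_i k i ^ 2 <= 4 * r)%N.
  rewrite -(ler_nat R) natr_sum natrM.
  apply: (@le_trans _ _ (\sum_i (2 * x i 0 ^+ 2 + 2))).
    apply: ler_sum => i _; rewrite natrX /k; case: ifP => _; last first.
      by rewrite expr0n /= addr_ge0 // mulr_ge0 ?sqr_ge0.
    have ba : (Num.truncn `|x i 0|)%:R <= `|x i 0| by rewrite truncn_le.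
    have := normr_ge0 (x i 0); have := ler0n R (Num.truncn `|x i 0|).
    rewrite -natr1 -[x i 0 ^+ 2]real_normK ?num_real //.
    move: ba; set a := `|_|; set b := (Num.truncn a)%:R => ba b0 a0.
    by have := sqr_ge0 (a - 1); nra.
  rewrite big_split /= -mulr_sumr sumr_const card_ord.
  have -> : \sum_i x i 0 ^+ 2 = dotv x x by apply: eq_bigr => i _; rewrite expr2.
  rewrite -[2 *+ r]mulr_natr; lra.
have kr i : (k i < (4 * r).+1)%N.
  rewrite ltnS (leq_trans _ ksq) // (bigD1 i) //= (leq_trans _ (leq_addr _ _)) //.
  by rewrite expnS expn1; case: (k i) => // m; rewrite leq_pmulr.
exists [ffun i => (x i 0 < 0, Ordinal (kr i))].
  by rewrite inE; apply: leq_trans ksq; apply: leq_sum => i _; rewrite ffunE.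
apply: ler_sum => i _; rewrite mxE ffunE /= /k.
case: (ltP 0 (c i * x i 0)) => // cx; last by rewrite mulr0n !mulr0.
have := truncnS_gt `|x i 0|; set N := _%:R => xN.
case: (ltrP (x i 0) 0) xN cx => x0 xN cx.
  by rewrite expr1 mulN1r; rewrite ltr0_norm // in xN; nra.
by rewrite expr0 mul1r; rewrite ger0_norm // in xN; nra.
Qed.

(** [r * b] is the largest absolute value of the form on the net. Its even power is at most the sum
    of all powers: a union bound in a form ready for expectations. *)
Lemma opbound_lattice (Y : 'M[R]_r) (k : nat) :
  (0 < r)%N -> (0 < k)%N -> ~~ odd k -> Y^T = Y ->
  exists b : R, [/\ 0 <= b, opbound Y b &
    (r%:R * b) ^+ k <= \sum_(z in lattice_net) \sum_(w in lattice_net)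
       dotv (lattice_vec z) (Y *m lattice_vec w) ^+ k].
Proof.
move=> r0 k0 keven YT; have R0 : 0 < r%:R :> R by rewrite ltr0n.
pose q z w := dotv (lattice_vec z) (Y *m lattice_vec w).
pose t : R := \big[Num.max/0]_(v in finset.setX lattice_net lattice_net) `|q v.1 v.2|.
have t0 : 0 <= t by rewrite /t; apply: bigmax_ge_id.
have q0 z w : 0 <= q z w ^+ k by rewrite exprn_even_ge0.
have S0 z : 0 <= \sum_(w in lattice_net) q z w ^+ k by rewrite sumr_ge0.
exists (t / r%:R); split; first by rewrite divr_ge0 // ltW.
  have qt z w : z \in lattice_net -> w \in lattice_net -> q z w <= t.
    move=> zN wN; apply: le_trans (ler_norm _) _.
    by apply: (bigmax_sup (z, w)) => //; rewrite inE zN wN.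
  have key x y : dotv x x <= r%:R -> dotv y y <= r%:R -> dotv y (Y *m x) <= t.
    move=> xr yr; have [z zN Hz] := lattice_round (fun i => (Y *m x) i 0) yr.
    have [w wN Hw] := lattice_round (fun i => (Y *m lattice_vec z) i 0) xr.
    apply: le_trans (qt _ _ wN zN).
    apply: (@le_trans _ _ (dotv (Y *m x) (lattice_vec z))); first by rewrite dotvC.
    by rewrite dotv_sym // dotvC /q [leRHS]dotvC.
  move=> x; have [x0|x0] := eqVneq (dotv x x) 0.
    by rewrite (dotv_eq0 x0) mulmx0 /dotv big1 ?mulr0 // => i _; rewrite mxE mulr0.
  have [y0|y0] := eqVneq (dotv (Y *m x) (Y *m x)) 0.
    by rewrite y0 mulr_ge0 ?sqr_ge0 ?dotv_ge0.
  have x1 : 0 < dotv x x by rewrite lt_def x0 dotv_ge0.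
  set y := Y *m x in y0 *.
  have y1 : 0 < dotv y y by rewrite lt_def y0 dotv_ge0.
  (* [s v] rescales [v] to squared norm [r]; applying [key] to the rescaled [x] and [Y *m x] gives
     the norm bound. *)
  pose s (v : 'cV[R]_r) : R := Num.sqrt (r%:R / dotv v v).
  have sE v : 0 < dotv v v -> s v ^+ 2 * dotv v v = r%:R.
    by move=> v0; rewrite sqr_sqrtr ?divr_ge0 ?(ltW v0) ?(ltW R0) // divfK // gt_eqF.
  have s0 v : 0 <= s v by rewrite sqrtr_ge0.
  have ss v : 0 < dotv v v -> dotv (s v *: v) (s v *: v) <= r%:R.
    by move=> v0; rewrite dotvZl dotvC dotvZl mulrA -expr2 sE.
  have := key _ _ (ss x x1) (ss y y1).
  rewrite -scalemxAr -/y dotvZl dotvC dotvZl => H.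
  have H2 : (s y * (s x * dotv y y)) ^+ 2 <= t ^+ 2.
    by rewrite lerXn2r ?nnegrE // ?mulr_ge0 // ltW.
  have : (s y * (s x * dotv y y)) ^+ 2 * dotv x x <= t ^+ 2 * dotv x x.
    by rewrite ler_wpM2r // ltW.
  have -> : (s y * (s x * dotv y y)) ^+ 2 * dotv x x =
     (s y ^+ 2 * dotv y y) * (s x ^+ 2 * dotv x x) * dotv y y by ring.
  rewrite !sE // => H3; rewrite expr_div_n mulrAC ler_pdivlMr ?exprn_gt0 //.
  by rewrite expr2 mulrC.
rewrite mulrC divfK ?gt_eqF //.
suff [] : 0 <= t /\
    t ^+ k <= \sum_(z in lattice_net) \sum_(w in lattice_net) q z w ^+ k by [].
rewrite /t; apply: (big_ind (fun x => 0 <= x /\ x ^+ k <= _)).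
- by split=> //; rewrite expr0n gtn_eqF //= sumr_ge0.
- by move=> x y xP yP; rewrite /Num.max; case: ifP.
case=> z w; rewrite inE /= => /andP[zN wN]; split=> //.
rewrite -normrX ger0_norm // (bigD1 z) //= (bigD1 w) //=.
by rewrite -addrA lerDl addr_ge0 // sumr_ge0.
Qed.

End Net.

Section SignMatrixMoment.
Variables (R : realType) (p : nat).
Hypothesis (p0 : (0 < p)%N).
Local Notation r := (2 * p)%N.

(** 4096 is [64 * 64], one factor for each of the two net points; [expR 256] comes from
    [bilinear_moment]. *)
Definition moment_cst : R := 4096 * expR 256.

Lemma bilinear_moment (x y : 'cV[R]_r) :
  dotv x x <= 4 * r%:R -> dotv y y <= 4 * r%:R ->
  sample_mean (fun f => dotv x (graph_mx (sample_val R f) *m y) ^+ r) <=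
  2 * expR (256 * r%:R) * (r%:R * Num.sqrt r%:R) ^+ r.
Proof.
move=> xr yr; have R0 : 0 < r%:R :> R by rewrite ltr0n muln_gt0.
have r0 : (0 < r)%N by rewrite muln_gt0.
have r_even : ~~ odd r by rewrite oddM.
pose a (e : vpair r) := x (val e).1 0 * y (val e).2 0 + x (val e).2 0 * y (val e).1 0.
(* The edge coefficients have square sum at most [2 * (4 * r) ^ 2], so with this [lam] the exponent
   in [sample_mgf] is at most [256 * r], a constant per unit of the moment order. *)
pose lam : R := (Num.sqrt r%:R)^-1.
have s0 : 0 < Num.sqrt r%:R :> R by rewrite sqrtr_gt0.
have mgf (b : R) : b ^+ 2 = lam ^+ 2 ->
    sample_mean (fun f => expR (\sum_e b * a e * sample_val R f e)) <= expR (256 * r%:R).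
  move=> bE; apply: le_trans (sample_mgf _) _; rewrite ler_expR.
  under eq_bigr do rewrite exprMn bE.
  rewrite -mulr_sumr exprVn sqr_sqrtr ?(ltW R0) //.
  have := sum_edge_weights x y; rewrite -/(a _) => H.
  have {}H : \sum_e a e ^+ 2 <= 32 * r%:R ^+ 2.
    apply: le_trans H _; have := dotv_ge0 x; have := dotv_ge0 y.
    set u := dotv x x in xr *; set v := dotv y y in yr *.
    move=> v0 u0; have := ler_pM u0 v0 xr yr.
    by set rr := r%:R; lra.
  have : r%:R^-1 * (\sum_e a e ^+ 2) <= 32 * r%:R by rewrite ler_pdivrMl // mulrCA -expr2.
  by lra.
apply: (@le_trans _ _ (sample_mean (fun f => (r%:R * Num.sqrt r%:R) ^+ r *
   (expR (\sum_e lam * a e * sample_val R f e) +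
    expR (\sum_e - lam * a e * sample_val R f e))))).
  apply: sample_mean_le => f; rewrite quad_graph.
  set S := \sum_e _.
  have sE (b : R) : \sum_e b * a e * sample_val R f e = b * S.
    by rewrite mulr_sumr; apply: eq_bigr => e _; rewrite mulrA.
  rewrite !sE mulNr.
  have -> : S = Num.sqrt r%:R * (lam * S) by rewrite mulrA divff ?mul1r // gt_eqF.
  rewrite exprMn [(r%:R * _) ^+ r]exprMn [r%:R ^+ r * _]mulrC -mulrA.
  rewrite ler_wpM2l ?exprn_ge0 ?(ltW s0) // [lam * (_ * _)]mulrA mulVf ?gt_eqF // mul1r.
  exact: exprn_le_expR.
rewrite sample_meanZ sample_meanD mulrC ler_wpM2r //.
  by rewrite exprn_ge0 // mulr_ge0 // ltW.
by rewrite [2 * _]mulr_natl mulr2n lerD // mgf // sqrrN.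
Qed.

Lemma sign_matrix_moment :
  sample_mean (fun f : sample r => \tr (graph_mx (sample_val R f) ^+ r)) <=
  2 * r%:R * (moment_cst * Num.sqrt r%:R) ^+ r.
Proof.
have R0 : 0 < r%:R :> R by rewrite ltr0n muln_gt0.
have r0 : (0 < r)%N by rewrite muln_gt0.
have r_even : ~~ odd r by rewrite oddM.
pose N := lattice_net r.
pose q (f : sample r) (z w : lattice r) :=
  dotv (lattice_vec R z) (graph_mx (sample_val R f) *m lattice_vec R w).
apply: (@le_trans _ _ (sample_mean (fun f => r%:R / r%:R ^+ r *
    \sum_(z in N) \sum_(w in N) q f z w ^+ r))).
  apply: sample_mean_le => f.
  have [b [b0 Yb bS]] := opbound_lattice r0 r0 r_even (graph_mx_tr (sample_val R f)).
  rewrite -mulrA; apply: (@le_trans _ _ (r%:R * b ^+ r)).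
    by have := tr_expr_le p (graph_mx_tr _) b0 Yb; rewrite (mulnC p).
  by rewrite ler_wpM2l ?(ltW R0) // ler_pdivlMl ?exprn_gt0 // -exprMn.
rewrite sample_meanZ sample_mean_sum.
under eq_bigr do rewrite sample_mean_sum.
apply: (@le_trans _ _ (r%:R / r%:R ^+ r * (\sum_(z in N) \sum_(w in N)
   2 * expR (256 * r%:R) * (r%:R * Num.sqrt r%:R) ^+ r))).
  rewrite ler_wpM2l ?divr_ge0 ?exprn_ge0 ?(ltW R0) //.
  apply: ler_sum => z zN; apply: ler_sum => w wN.
  by apply: bilinear_moment; apply: lattice_net_norm.
have card0 := card_lattice_net R r.
set C := 2 * _ * _.
have -> : \sum_(z in N) \sum_(w in N) C = C * #|N|%:R * #|N|%:R.
  by rewrite !sumr_const !mulr_natr.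
apply: (@le_trans _ _ (r%:R / r%:R ^+ r * (C * 64 ^+ r * 64 ^+ r))).
  have C0 : 0 <= C by rewrite !mulr_ge0 ?exprn_ge0 ?mulr_ge0 ?expR_ge0 ?sqrtr_ge0 // ltW.
  rewrite ler_wpM2l ?divr_ge0 ?exprn_ge0 ?(ltW R0) //.
  apply: (ler_pM _ _ (ler_wpM2l C0 card0) card0) => //.
  exact: (mulr_ge0 C0 (ler0n _ _)).
rewrite /C expRM_natr !exprMn.
have -> : (4096 : R) = 64 * 64 by ring.
rewrite exprMn le_eqVlt; apply/orP; left; apply/eqP; field.
by rewrite expf_neq0 // gt_eqF.
Qed.

End SignMatrixMoment.

(** * Moments of the centered adjacency matrix *)

Lemma map_Some_pmap (T : eqType) (l : seq (option T)) :
  None \notin l -> l = [seq Some x | x <- pmap id l].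
Proof.
elim: l => //= -[x|] l IHl; rewrite inE //= => nl.
by rewrite -IHl.
Qed.

Lemma prod_expr_count (R : comPzRingType) (T : finType) (f : T -> R) (l : seq T) :
  \prod_(e <- l) f e = \prod_e f e ^+ count_mem e l.
Proof.
elim: l => [|a l IHl]; first by rewrite big_nil big1.
rewrite big_cons IHl; under [RHS]eq_bigr do rewrite /= exprD.
rewrite big_split; congr (_ * _).
rewrite (bigD1 a) //= eqxx expr1 big1 ?mulr1 // => e /negbTE.
by rewrite eq_sym => ->.
Qed.

Lemma prod_undup (R : comPzRingType) (T : finType) (f : T -> R) (l : seq T) :
  \prod_(e <- undup l) f e = \prod_e if e \in l then f e else 1.
Proof.
rewrite big_uniq ?undup_uniq // big_mkcond; apply: eq_bigr => e _.
by rewrite mem_undup.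
Qed.

Lemma repeated_Some (T : eqType) (l : seq T) :
  repeated [seq Some x | x <- l] = all (fun x => 1 < count_mem x l)%N l.
Proof.
rewrite /repeated all_map.
have -> : None \in [seq Some x | x <- l] = false by apply/negbTE/mapP => -[].
by apply: eq_all => x /=; rewrite count_map.
Qed.

Lemma undup_Some (T : eqType) (l : seq T) :
  undup [seq Some x | x <- l] = [seq Some x | x <- undup l].
Proof. by rewrite undup_map_inj // => x y []. Qed.

Lemma prod_oapp_None (R : comPzRingType) (T : eqType) (f : T -> R) (l : seq (option T)) :
  None \in l -> \prod_(o <- l) oapp f 0 o = 0.
Proof. by move=> lN; rewrite (big_rem None) //= mul0r. Qed.

Section CoinMoments.
Variables (R : realType) (r : nat).

Lemma coin_moment_ge0 (c : nat) : 0 <= coin_mean (fun o => coin_val R o ^+ c).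
Proof.
rewrite (coin_meanE (fun y => y ^+ c)) divr_ge0 //.
case: c => [|[|c]]; first by rewrite !expr0; lra.
  by rewrite !expr1; lra.
have : 4 <= (2 : R) ^+ c.+2.
  rewrite !exprS; have : 1 <= (2 : R) ^+ c by rewrite exprn_ege1 // ler1n.
  by lra.
by rewrite -signr_odd; case: (odd _); rewrite ?expr1 ?expr0; lra.
Qed.

Lemma coin_moment_ge1 (c : nat) : c != 1%N -> 1 <= coin_mean (fun o => coin_val R o ^+ c).
Proof.
rewrite (coin_meanE (fun y => y ^+ c)) ler_pdivlMr // mul1r.
case: c => [|[|[|c]]] // _; first by rewrite !expr0; lra.
  by rewrite !expr2; lra.
have : 8 <= (2 : R) ^+ c.+3.
  rewrite !exprS; have : 1 <= (2 : R) ^+ c by rewrite exprn_ege1 // ler1n.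
  by lra.
by rewrite -signr_odd; case: (odd _); rewrite ?expr1 ?expr0; lra.
Qed.

(** By independence the mean is a product of coin moments: nonnegative in general, and each at least
    1 when no multiplicity equals 1. *)
Lemma sample_walk_ge (l : seq (option (vpair r))) :
  (repeated l)%:R <= sample_mean (fun f => \prod_(o <- l) oapp (sample_val R f) 0 o).
Proof.
have [lN|lN] := boolP (None \in l).
  rewrite /repeated lN /= /sample_mean big1 // => f _.
  by rewrite prod_oapp_None ?mulr0.
rewrite (map_Some_pmap lN); set l' := pmap id l.
have -> : sample_mean (fun f =>
      \prod_(o <- [seq Some x | x <- l']) oapp (sample_val R f) 0 o)
    = \prod_e coin_mean (fun o => coin_val R o ^+ count_mem e l').
  rewrite -(sample_mean_prod (fun e y => y ^+ count_mem e l')).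
  by apply: eq_bigr => f _; congr (_ * _); rewrite big_map prod_expr_count.
rewrite repeated_Some; case: allP => [l2|_]; last first.
  by apply: prodr_ge0 => e _; apply: coin_moment_ge0.
rewrite (_ : true%:R = \prod_(e : vpair r) 1); last by rewrite big1.
apply: ler_prod => e _; rewrite ler01 coin_moment_ge1 //.
have [/l2|/count_memPn -> //] := boolP (e \in l').
by case: (count_mem e l') => [|[]].
Qed.
End CoinMoments.

Section SBM.
Variables (R : realType) (n k : nat) (p q : R) (cl : 'I_n -> 'I_k).
Hypotheses (p01 : 0 <= p <= 1) (q01 : 0 <= q <= 1).

Local Notation pe := (edge_prob p q cl).

Lemma edge_prob01 e : 0 <= pe e <= 1.
Proof. by rewrite /edge_prob; case: ifP. Qed.

Lemma sbm_mass_ge0 G : 0 <= sbm_mass p q cl G.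
Proof.
apply: prodr_ge0 => e _; have /andP[e0 e1] := edge_prob01 e.
by case: ifP; rewrite ?subr_ge0.
Qed.

Lemma sbm_mean_prod (g : vpair n -> bool -> R) :
  \sum_(G : graph n) sbm_mass p q cl G * \prod_e g e (e \in G) =
  \prod_e (pe e * g e true + (1 - pe e) * g e false).
Proof.
rewrite bigA_distr; apply: eq_bigr => G _; rewrite -big_split.
by apply: eq_bigr => e _; case: ifP.
Qed.

Lemma sum_sbm_mass : \sum_(G : graph n) sbm_mass p q cl G = 1.
Proof.
have := sbm_mean_prod (fun _ _ => 1); rewrite [RHS]big1 => [<-|e _].
  by apply: eq_bigr => G _; rewrite big1 ?mulr1.
by ring.
Qed.

Definition centered (G : graph n) (e : vpair n) : R := (e \in G)%:R - pe e.

Definition edge_weight (o : option (vpair n)) : R := oapp pe 0 o.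

Lemma edge_weight_ge0 o : 0 <= edge_weight o.
Proof. by case: o => //= e; case/andP: (edge_prob01 e). Qed.

Lemma edge_weight_le1 o : edge_weight o <= 1.
Proof. by case: o => //= e; case/andP: (edge_prob01 e). Qed.

(** The centered variable is bounded by 1, so its moments of order at least 2 are dominated by its
    variance [x * (1 - x)]. *)
Lemma centered_moment (x : R) (c : nat) : 0 <= x <= 1 ->
  `|x * (1 - x) ^+ c + (1 - x) * (0 - x) ^+ c|
    <= if c == 0%N then 1 else if c == 1%N then 0 else x.
Proof.
case/andP=> x0 x1; case: c => [|[|c]].
- by rewrite !expr0 !mulr1 addrC subrK normr1.
- by rewrite !expr1 (_ : x * (1 - x) + (1 - x) * (0 - x) = 0) ?normr0 //; ring.
have h1 : 0 <= 1 - x by rewrite subr_ge0.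
have p1 : (1 - x) ^+ c.+2 <= (1 - x) ^+ 2 by rewrite ler_wiXn2l // lerBlDr lerDl.
have p2 : x ^+ c.+2 <= x ^+ 2 by rewrite ler_wiXn2l.
have : `|(0 - x) ^+ c.+2| <= x ^+ 2 by rewrite normrX sub0r normrN ger0_norm.
have p0 : 0 <= (1 - x) ^+ c.+2 by rewrite exprn_ge0.
rewrite !ler_norml; move: p0 p1; set a := (1 - x) ^+ _; set b := (0 - x) ^+ _.
by move=> p0 p1 /andP[b1 b2]; apply/andP; split; nra.
Qed.

Lemma sbm_walk_le (l : seq (option (vpair n))) :
  \sum_(G : graph n) sbm_mass p q cl G * \prod_(o <- l) oapp (centered G) 0 o
    <= if repeated l then \prod_(o <- undup l) edge_weight o else 0.
Proof.
have [lN|lN] := boolP (None \in l).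
  rewrite /repeated lN /= big1 // => f _.
  by rewrite prod_oapp_None ?mulr0.
rewrite (map_Some_pmap lN); set l' := pmap id l.
have -> : \sum_(G : graph n) sbm_mass p q cl G *
      \prod_(o <- [seq Some x | x <- l']) oapp (centered G) 0 o =
    \prod_e (pe e * (1 - pe e) ^+ count_mem e l'
             + (1 - pe e) * (0 - pe e) ^+ count_mem e l').
  rewrite -(sbm_mean_prod (fun e b => (b%:R - pe e) ^+ count_mem e l')).
  by apply: eq_bigr => f _; rewrite big_map prod_expr_count.
apply: le_trans (ler_norm _) _; rewrite normr_prod.
apply: (@le_trans _ _ (\prod_e if count_mem e l' == 0%N then 1 else
          if count_mem e l' == 1%N then 0 else pe e)).
  by apply: ler_prod => e _; rewrite normr_ge0 centered_moment ?edge_prob01.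
rewrite repeated_Some; case: ifPn => [/allP l2|].
  rewrite undup_Some big_map prod_undup le_eqVlt; apply/orP; left; apply/eqP.
  apply: eq_bigr => e _; have [el|/count_memPn -> //] := boolP (e \in l').
  by have := l2 e el; case: (count_mem e l') => [|[]].
case/allPn => e el; rewrite -leqNgt leq_eqVlt ltnS leqn0 => ec.
rewrite (bigD1 e) //=.
have -> : (count_mem e l' == 0%N) = false.
  by apply/negbTE; rewrite -lt0n -has_count has_pred1.
case/orP: ec => [->|/eqP c0]; first by rewrite mul0r.
by move: el; rewrite -has_pred1 has_count c0.
Qed.

Lemma expected_trace (P : nat) : (0 < P)%N ->
  (forall y : 'I_n, \sum_x edge_weight (oedge x y) <= P%:R) ->
  \sum_(G : graph n) sbm_mass p q cl G * \tr (graph_mx (centered G) ^+ (2 * P))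
    <= 2 * n%:R * (moment_cst R * Num.sqrt (2 * P)%:R) ^+ (2 * P).
Proof.
move=> P0 wP; have r0 : (0 < 2 * P)%N by rewrite muln_gt0.
have R0 : 0 < (2 * P)%:R :> R by rewrite ltr0n.
under eq_bigr do rewrite tr_cycles // mulr_sumr.
rewrite exchange_big /=.
apply: le_trans (ler_sum (words 'I_n (2 * P))
                   (fun u _ => sbm_walk_le (edges (cycle_steps u)))) _.
rewrite -big_mkcond.
apply: le_trans (walk_comparison P0 edge_weight_ge0 edge_weight_le1 wP) _.
have H : \sum_(v <- words 'I_(2 * P) (2 * P)) (repeated (edges (cycle_steps v)))%:R
   <= 2 * (2 * P)%:R * (moment_cst R * Num.sqrt (2 * P)%:R) ^+ (2 * P).
  apply: le_trans (sign_matrix_moment R P0).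
  rewrite (_ : sample_mean _ = sample_mean (fun f : sample (2 * P) =>
      \sum_(u <- words 'I_(2 * P) (2 * P))
        \prod_(o <- edges (cycle_steps u)) oapp (sample_val R f) 0 o)).
    by rewrite sample_mean_sum; apply: ler_sum => v _; apply: sample_walk_ge.
  by apply: eq_bigr => f _; rewrite tr_cycles.
apply: le_trans (ler_wpM2l _ H) _; first by rewrite divr_ge0.
rewrite le_eqVlt; apply/orP; left; apply/eqP.
move: ((moment_cst R * _) ^+ _) => M.
by rewrite !mulrA; congr (_ * _); rewrite mulrAC mulfVK ?gt_eqF // mulrC.
Qed.

(** Markov's inequality; the even power makes the trace nonnegative outside the event. *)
Lemma trace_tail (P : nat) (B : R) : (0 < P)%N -> 0 < B ->
  (forall y : 'I_n, \sum_x edge_weight (oedge x y) <= P%:R) ->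
  \sum_(G : graph n | B ^+ (2 * P) < \tr (graph_mx (centered G) ^+ (2 * P)))
     sbm_mass p q cl G
    <= 2 * n%:R * (moment_cst R * Num.sqrt (2 * P)%:R / B) ^+ (2 * P).
Proof.
move=> P0 B0 wP; have BP0 : 0 < B ^+ (2 * P) by rewrite exprn_gt0.
rewrite expr_div_n mulrA ler_pdivlMr //; apply: le_trans (expected_trace P0 wP).
rewrite mulr_suml big_mkcond; apply: ler_sum => G _.
have m0 := sbm_mass_ge0 G; case: ifP => [/ltW h|_]; first by rewrite ler_wpM2l.
by rewrite mulr_ge0 // (mulnC 2%N) tr_expr_ge0 ?graph_mx_tr.
Qed.

End SBM.

(** * The dual certificate *)

Section Gram.
Variables (R : realType) (n : nat).
Implicit Types (Y : 'M[R]_n) (x y : 'cV[R]_n).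

Lemma dotvDr x y z : dotv x (y + z) = dotv x y + dotv x z.
Proof. by rewrite dotvC dotvDl ![dotv _ x]dotvC. Qed.

Lemma dotvZr (a : R) x y : dotv x (a *: y) = a * dotv x y.
Proof. by rewrite dotvC dotvZl dotvC. Qed.

Lemma quadD Y x y (t : R) : Y^T = Y ->
  dotv (x + t *: y) (Y *m (x + t *: y)) =
  dotv x (Y *m x) + 2 * t * dotv x (Y *m y) + t ^+ 2 * dotv y (Y *m y).
Proof.
move=> YT; rewrite mulmxDr -scalemxAr dotvDl !dotvDr !dotvZl !dotvZr.
have -> : dotv y (Y *m x) = dotv x (Y *m y) by rewrite -dotv_sym // dotvC.
by ring.
Qed.

Lemma dotv_delta x (i : 'I_n) : dotv (delta_mx i 0) x = x i 0.
Proof.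
rewrite /dotv (bigD1 i) //= mxE !eqxx mul1r big1 ?addr0 // => j ji.
by rewrite mxE (negbTE ji) mul0r.
Qed.

Lemma mulmx_delta Y (i j : 'I_n) : (Y *m (delta_mx i 0 : 'cV_n)) j 0 = Y j i.
Proof. by rewrite -colE mxE. Qed.

Lemma psdmxP Y : psdmx Y <-> Y^T = Y /\ forall x, 0 <= dotv x (Y *m x).
Proof.
by split=> -[YT Y0]; split=> // x; have := Y0 x; rewrite -mulmxA dotvE.
Qed.

(** Cholesky elimination from the last index downwards: the induction is on a bound [j] beyond which
    all rows vanish. *)
Lemma psd_gram Y : psdmx Y ->
  exists s : seq 'cV[R]_n, Y = \sum_(v <- s) v *m v^T.
Proof.
suff gram j : psdmx Y -> (forall i l : 'I_n, (j <= i)%N -> Y i l = 0) ->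
    exists s : seq 'cV[R]_n, Y = \sum_(v <- s) v *m v^T.
  by move=> Yp; apply: (gram n) => // i l; rewrite leqNgt ltn_ord.
elim: j Y => [|j IHj] Y Yp Yz.
  by exists [::]; rewrite big_nil; apply/matrixP => i l; rewrite Yz // mxE.
have [jn|nj] := ltnP j n; last first.
  by apply: IHj => // i l ji; have := ltn_ord i; rewrite ltnNge (leq_trans nj ji).
pose o := Ordinal jn; pose e : 'cV[R]_n := delta_mx o 0.
have [YT Y0] := (psdmxP Y).1 Yp.
have Ysym i l : Y i l = Y l i by rewrite -[in LHS]YT mxE.
have qe : dotv e (Y *m e) = Y o o by rewrite dotv_delta mulmx_delta.
have d0 : 0 <= Y o o by rewrite -qe.
have [doo|doo] := eqVneq (Y o o) 0.
  apply: IHj => // i l; rewrite leq_eqVlt => /orP[/eqP ji|]; last exact: Yz.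
  have -> : i = o by apply: val_inj.
  (* Zero pivot: along this line the form is affine in [t] and nonnegative, so its slope vanishes,
     and row [o] with it. *)
  have H t := Y0 (delta_mx l 0 + t *: e).
  have {}H t : 0 <= Y l l + 2 * t * Y l o.
    have := H t; rewrite quadD // qe doo mulr0 addr0.
    by rewrite !dotv_delta !mulmx_delta.
  rewrite Ysym; apply/eqP; apply: contraT => Ylo.
  have := H (- (Y l l + 1) / (2 * Y l o)).
  have -> : 2 * (- (Y l l + 1) / (2 * Y l o)) * Y l o = - (Y l l + 1) by field.
  by lra.
have dp : 0 < Y o o by rewrite lt_def doo.
pose v : 'cV[R]_n := (Num.sqrt (Y o o))^-1 *: (Y *m e).
have vvE i l : (v *m v^T) i l = Y i o * Y l o / Y o o.
  have vi a : v a 0 = (Num.sqrt (Y o o))^-1 * Y a o by rewrite mxE mulmx_delta.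
  rewrite mxE big_ord_recl big_ord0 addr0 [v^T _ _]mxE !vi.
  rewrite mulrACA -invfM -expr2 sqr_sqrtr // mulrC; congr (_ * _).
have [||s sE] := IHj (Y - v *m v^T).
- apply/psdmxP; split.
    by rewrite linearB /= trmx_mul trmxK YT.
  (* The form of the Schur complement at [x] is the minimum of the form of [Y] on the line through
     [x] in direction [e]. *)
  move=> x; have := Y0 (x + (- dotv x (Y *m e) / Y o o) *: e).
  have vx : v *m v^T *m x = dotv v x *: v.
    rewrite -mulmxA [v^T *m x](_ : _ = (dotv v x)%:M) ?mul_mx_scalar //.
    by apply/matrixP => a b; rewrite !ord1 dotvE !mxE mulr1n.
  have -> : dotv x ((Y - v *m v^T) *m x) =
      dotv x (Y *m x) - dotv x (Y *m e) ^+ 2 / Y o o.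
    rewrite mulmxBl vx -scaleNr dotvDr dotvZr [dotv v x]dotvC mulNr -expr2.
    by rewrite dotvZr exprMn exprVn sqr_sqrtr // mulrC.
  rewrite quadD // qe; congr (_ <= _).
  by field.
- move=> i l ji; have -> : (Y - v *m v^T) i l = Y i l - Y i o * Y l o / Y o o.
    by rewrite -vvE !mxE.
  move: ji; rewrite leq_eqVlt => /orP[/eqP ji|ji].
    have -> : i = o by apply: val_inj.
    by rewrite mulrAC divff // mul1r Ysym subrr.
  by rewrite !(Yz i) // mul0r mul0r subrr.
by exists (v :: s); rewrite big_cons -sE addrC subrK.
Qed.

End Gram.

Lemma mxdotE (R : realType) (n : nat) (A Y : 'M[R]_n) :
  mxdot A Y = \sum_i \sum_j A i j * Y i j.
Proof.
rewrite /mxdot /mxtrace exchange_big; apply: eq_bigr => j _.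
by rewrite mxE; apply: eq_bigr => i _; rewrite mxE.
Qed.

Section Clusters.
Variables (R : realType) (n k m : nat) (cl : 'I_n -> 'I_k).
Hypotheses (bal : balanced m cl) (k2 : (2 <= k)%N) (m0 : (0 < m)%N) (nkm : n = (k * m)%N).

Lemma m_gt0 : 0 < m%:R :> R. Proof. by rewrite ltr0n. Qed.

Lemma k1_gt0 : 0 < k%:R - 1 :> R.
Proof. by rewrite subr_gt0 ltr1n. Qed.

Lemma sum_by_cluster (F : 'I_n -> R) : \sum_i F i = \sum_t \sum_(i | cl i == t) F i.
Proof. exact: (partition_big cl predT). Qed.

Lemma sum_cluster_const (t : 'I_k) (a : R) : \sum_(i | cl i == t) a = m%:R * a.
Proof.
rewrite sumr_const mulr_natl; congr (_ *+ _); rewrite -(bal t).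
by apply: eq_card => i; rewrite !inE.
Qed.

Lemma sum_cluster_fun (g : 'I_k -> R) : \sum_i g (cl i) = m%:R * \sum_t g t.
Proof.
rewrite sum_by_cluster mulr_sumr; apply: eq_bigr => t _.
by rewrite -(sum_cluster_const t); apply: eq_bigr => i /eqP->.
Qed.

Definition centered_vec (w : 'cV[R]_n) := forall t, \sum_(i | cl i == t) w i 0 = 0.

Lemma centered_vec_sum (w : 'cV[R]_n) (g : 'I_k -> R) :
  centered_vec w -> \sum_i w i 0 * g (cl i) = 0.
Proof.
move=> wc; rewrite sum_by_cluster big1 // => t _.
rewrite (eq_bigr (fun i => w i 0 * g t)) => [|i /eqP-> //].
by rewrite -mulr_suml wc mul0r.
Qed.

Lemma partition_mx_cols (j : 'I_n) : \sum_i (partition_mx R cl) i j = 0.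
Proof.
transitivity (\sum_i (if cl i == cl j then 1 else - (k%:R - 1)^-1) : R).
  by apply: eq_bigr => i _; rewrite mxE.
rewrite (sum_cluster_fun (fun t => if t == cl j then 1 else - (k%:R - 1)^-1)).
rewrite (bigD1 (cl j)) //= eqxx (eq_bigr (fun=> - (k%:R - 1)^-1)); last first.
  by move=> t /negbTE->.
rewrite sumr_const (_ : #|_| = k.-1); last first.
  by rewrite cardC1 card_ord.
rewrite -[_ *+ k.-1]mulr_natr -subn1 natrB ?(ltnW k2) // mulNr mulVf ?gt_eqF ?k1_gt0 //.
by rewrite subrr mulr0.
Qed.

Lemma partition_mx_sym : (partition_mx R cl)^T = partition_mx R cl.
Proof. by apply/matrixP => i j; rewrite !mxE eq_sym. Qed.

Lemma partition_mx_feasible : sdp_feasible k (partition_mx R cl).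
Proof.
have k1 := k1_gt0; split=> [i|i j|]; first by rewrite mxE eqxx.
  rewrite mxE; case: ifP => // _; apply: (@le_trans _ _ 0) => //.
  by rewrite oppr_le0 invr_ge0 ltW.
apply/psdmxP; split=> [|x]; first exact: partition_mx_sym.
pose b : R := (k%:R - 1)^-1.
pose s : 'cV[R]_k := \col_t \sum_(i | cl i == t) x i 0.
pose u : 'cV[R]_k := const_mx 1.
have uu : dotv u u = k%:R.
  rewrite /dotv (eq_bigr (fun=> 1)) => [|t _]; last by rewrite mxE mulr1.
  by rewrite sumr_const card_ord.
have xs : \sum_i x i 0 = dotv u s.
  by rewrite sum_by_cluster; apply: eq_bigr => t _; rewrite !mxE mul1r.
have -> : dotv x (partition_mx R cl *m x) = (1 + b) * dotv s s - b * dotv u s ^+ 2.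
  have row i : (partition_mx R cl *m x) i 0 = (1 + b) * s (cl i) 0 - b * dotv u s.
    rewrite -xs !mxE [X in (1 + b) * X]big_mkcond 2!mulr_sumr -sumrB; apply: eq_bigr => j _.
    by rewrite mxE eq_sym; case: eqP => _; rewrite -/b; ring.
  rewrite /dotv (eq_bigr (fun i => x i 0 * ((1 + b) * s (cl i) 0) - b * dotv u s * x i 0)).
    rewrite sumrB -mulr_sumr xs; congr (_ - _); last by rewrite expr2 mulrA.
    rewrite sum_by_cluster mulr_sumr; apply: eq_bigr => t _.
    rewrite (eq_bigr (fun i => x i 0 * ((1 + b) * s t 0))) => [|i /eqP-> //].
    by rewrite -mulr_suml [s t 0 in RHS]mxE mulrCA [s t 0]mxE.
  by move=> i _; rewrite row; ring.
(* Since [1 + b = b * k], nonnegativity is Cauchy-Schwarz between the cluster sums and the all-ones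
   vector. *)
have := dotv_CS u s; rewrite uu => H.
have b0 : 0 <= b by rewrite invr_ge0 ltW.
have -> : 1 + b = b * k%:R by rewrite /b; field; rewrite gt_eqF.
by rewrite -mulrA -mulrBr mulr_ge0 // subr_ge0.
Qed.

End Clusters.

(** * Optimality and uniqueness from the dual matrix *)

Section Certificate.
Variables (R : realType) (n k m : nat) (cl : 'I_n -> 'I_k).
Hypotheses (bal : balanced m cl) (k2 : (2 <= k)%N) (m0 : (0 < m)%N) (nkm : n = (k * m)%N).
Variable A : 'M[R]_n.
Hypothesis AT : A^T = A.

Local Notation c := (cross_max cl A).
Local Notation M0 := (m_gt0 R m0).

Definition cross_value (u v : 'I_n) : R :=
  delta_vc cl A u (cl v) + delta_vc cl A v (cl u) - delta_cc cl A (cl v) (cl u) / m%:R.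

Lemma cluster_size : n%:R / k%:R = m%:R :> R.
Proof. by rewrite nkm natrM mulrAC divff ?mul1r // pnatr_eq0 -lt0n ltnW. Qed.

Lemma cross_max_ge u v : cl u != cl v -> cross_value u v <= c.
Proof.
move=> uv; apply: ub_le_sup; last by exists u, v; rewrite cluster_size.
exists (\sum_u \sum_v `|cross_value u v|) => _ [u' [v' [_ ->]]].
rewrite cluster_size -/(cross_value u' v'); apply: le_trans (ler_norm _) _.
rewrite (bigD1 u') //= (bigD1 v') //= -addrA lerDl addr_ge0 ?sumr_ge0 // => i _.
by rewrite sumr_ge0.
Qed.

Lemma Asym i j : A i j = A j i.
Proof. by rewrite -[in LHS]AT mxE. Qed.

Lemma delta_ccC s t : delta_cc cl A s t = delta_cc cl A t s.
Proof.
rewrite /delta_cc exchange_big; apply: eq_bigr => i _.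
by apply: eq_bigr => j _; apply: Asym.
Qed.

(** Summed over [j] in another cluster [t], the terms [delta_vc cl A j (cl i)] add up to [delta_cc]
    and cancel the last term of [cross_value]; what remains is [c - delta_vc cl A i t], so that row
    [i] of [A] plus slack sums to [c] over [t]. *)
Definition slack (i j : 'I_n) : R :=
  if cl i == cl j then 0 else (c - cross_value i j) / m%:R.

Lemma slack_ge0 i j : 0 <= slack i j.
Proof.
rewrite /slack; case: eqVneq => // ij.
by rewrite divr_ge0 ?subr_ge0 ?cross_max_ge // ltW ?M0.
Qed.

Lemma slackC i j : slack i j = slack j i.
Proof.
by rewrite /slack eq_sym /cross_value (delta_ccC (cl j)) [delta_vc _ _ i _ + _]addrC.
Qed.

Definition dual_mx : 'M[R]_n :=
  \matrix_(i, j) ((if i == j then nu cl A i else 0) - A i j - slack i j + 2^-1).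

Lemma dual_mx_sym : dual_mx^T = dual_mx.
Proof.
by apply/matrixP => i j; rewrite !mxE slackC Asym eq_sym; case: eqP => [->|].
Qed.

Lemma dual_mx_cluster i t :
  \sum_(j | cl j == t) dual_mx i j = m%:R / 2 - c.
Proof.
rewrite (eq_bigr (fun j => (if i == j then nu cl A i else 0) - A i j - slack i j + 2^-1));
  last by move=> j _; rewrite mxE.
rewrite big_split /= sumrB sumrB (sum_cluster_const bal).
rewrite -/(delta_vc cl A i t).
have [it|it] := eqVneq (cl i) t.
  rewrite (bigD1 i) ?it //= eqxx big1 ?addr0; last first.
    by move=> j /andP[_]; rewrite eq_sym => /negbTE->.
  rewrite big1 => [|j /eqP jt]; last by rewrite /slack it jt eqxx.
  by rewrite /nu /delta_in it; ring.
rewrite big1 => [|j /eqP jt]; last first.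
  by case: eqP => // ij; rewrite ij jt eqxx in it.
rewrite (eq_bigr (fun j => (c - delta_vc cl A i t + delta_cc cl A t (cl i) / m%:R) / m%:R
    - delta_vc cl A j (cl i) / m%:R)); last first.
  by move=> j /eqP jt; rewrite /slack jt (negbTE it) /cross_value jt; ring.
rewrite sumrB (sum_cluster_const bal) -mulr_suml -/(delta_cc cl A t (cl i)).
by field; rewrite gt_eqF ?M0.
Qed.

(** The slack is a function of [i] and the cluster of [j] plus a function of [j] and the cluster of
    [i]. Each part vanishes when paired with a vector that sums to 0 over every cluster. *)
Lemma dual_mx_centered (w : 'cV[R]_n) : centered_vec cl w ->
  dotv w (dual_mx *m w) = \sum_i nu cl A i * w i 0 ^+ 2 - dotv w (A *m w).
Proof.
move=> wc.
pose al (i : 'I_n) (t : 'I_k) : R := if cl i == t then 0 else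
   (c - delta_vc cl A i t + delta_cc cl A t (cl i) / m%:R) / m%:R.
pose be (j : 'I_n) (s : 'I_k) : R := if s == cl j then 0 else - delta_vc cl A j s / m%:R.
have slackE i j : slack i j = al i (cl j) + be j (cl i).
  rewrite /slack /al /be; case: eqP => _; first by rewrite addr0.
  by rewrite /cross_value; ring.
have row i : (dual_mx *m w) i 0 = nu cl A i * w i 0 - (A *m w) i 0
    - \sum_j be j (cl i) * w j 0.
  rewrite !mxE (eq_bigr (fun j => (if i == j then nu cl A i * w i 0 else 0) -
    A i j * w j 0 - be j (cl i) * w j 0 + w j 0 * (2^-1 - al i (cl j)))); last first.
    by move=> j _; rewrite mxE slackE; case: eqP => [->|_]; ring.
  rewrite big_split /= !sumrB (centered_vec_sum (fun t => 2^-1 - al i t)) // addr0.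
  congr (_ - _ - _); rewrite (bigD1 i) //= eqxx big1 ?addr0 // => j.
  by rewrite eq_sym => /negbTE->.
rewrite /dotv (eq_bigr (fun i => nu cl A i * w i 0 ^+ 2 - w i 0 * (A *m w) i 0
   - w i 0 * \sum_j be j (cl i) * w j 0)); last by move=> i _; rewrite row; ring.
by rewrite !sumrB (centered_vec_sum (fun t => \sum_j be j t * w j 0)) // subr0.
Qed.

Hypothesis c_lt : c < m%:R / 2.
Hypothesis A_lt : forall w : 'cV[R]_n, centered_vec cl w -> w != 0 ->
  dotv w (A *m w) < \sum_i nu cl A i * w i 0 ^+ 2.

(** Split [v] into its cluster averages [b] and a centered rest [w]. Equal row sums make
    [dual_mx *m b] constant, so the cross terms vanish, and the averages contribute [h * m * T ^ 2].
    The equality case feeds uniqueness. *)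
Lemma dual_mx_psd (v : 'cV[R]_n) :
  0 <= dotv v (dual_mx *m v) /\
  (dotv v (dual_mx *m v) = 0 ->
   (forall i j, cl i = cl j -> v i 0 = v j 0) /\ \sum_i v i 0 = 0).
Proof.
pose g t := (\sum_(i | cl i == t) v i 0) / m%:R.
pose b : 'cV[R]_n := \col_i g (cl i).
pose w := v - b; pose T := \sum_t g t; pose h := m%:R / 2 - c.
have h0 : 0 < h by rewrite subr_gt0.
have wc : centered_vec cl w.
  move=> t; rewrite (eq_bigr (fun i => v i 0 - g t)) => [|i /eqP it]; last first.
    by rewrite !mxE it.
  by rewrite sumrB (sum_cluster_const bal) /g mulrC divfK ?subrr // gt_eqF ?M0.
have vE : v = w + b by rewrite subrK.
have Mb : dual_mx *m b = const_mx (h * T).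
  apply/matrixP => i j; rewrite ord1 !mxE (sum_by_cluster cl) mulr_sumr.
  apply: eq_bigr => t _.
  rewrite (eq_bigr (fun j => dual_mx i j * g t)) => [|l /eqP lt]; last first.
    by rewrite [b _ _]mxE lt.
  by rewrite -mulr_suml dual_mx_cluster.
have sv : \sum_i v i 0 = m%:R * T.
  rewrite (sum_by_cluster cl) mulr_sumr; apply: eq_bigr => t _.
  by rewrite /g mulrC divfK // gt_eqF ?M0.
have dc (x : 'cV[R]_n) a : dotv x (const_mx a) = a * \sum_i x i 0.
  by rewrite mulr_sumr; apply: eq_bigr => i _; rewrite mxE mulrC.
have w0 : \sum_i w i 0 = 0.
  rewrite -[RHS](centered_vec_sum (fun=> 1) wc).
  by apply: eq_bigr => i _; rewrite mulr1.
have qE : dotv v (dual_mx *m v) = dotv w (dual_mx *m w) + h * m%:R * T ^+ 2.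
  have -> : dual_mx *m v = dual_mx *m w + const_mx (h * T) by rewrite {1}vE mulmxDr Mb.
  rewrite dotvDr dc sv {1}vE dotvDl.
  have -> : dotv b (dual_mx *m w) = dotv (dual_mx *m b) w.
    by rewrite dotv_sym ?dual_mx_sym.
  rewrite Mb.
  by rewrite [dotv (const_mx _) _]dotvC dc w0; ring.
have qw : 0 <= dotv w (dual_mx *m w).
  have [->|wn] := eqVneq w 0.
    by rewrite mulmx0 /dotv big1 // => i _; rewrite mxE mulr0.
  by rewrite dual_mx_centered // subr_ge0 ltW ?A_lt.
have hm : 0 < h * m%:R by rewrite mulr_gt0 ?M0.
have hT : 0 <= h * m%:R * T ^+ 2 by rewrite mulr_ge0 ?sqr_ge0 // ltW.
rewrite qE; split; first exact: addr_ge0.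
move=> /eqP; rewrite paddr_eq0 //; case/andP=> qw0.
rewrite mulf_eq0 (gt_eqF hm) /= sqrf_eq0 => /eqP T0.
have {}w0 : w = 0.
  apply/eqP; apply: contraT => wn; have := A_lt wc wn.
  by rewrite -subr_gt0 -dual_mx_centered // (eqP qw0) ltxx.
split; last by rewrite sv T0 mulr0.
by move=> i j ij; rewrite vE w0 add0r !mxE ij.
Qed.

Local Notation Y0 := (partition_mx R cl).

Lemma mxdot_dual (Y : 'M[R]_n) : (forall i, Y i i = 1) ->
  mxdot (2 *: A - const_mx 1) Y =
  2 * (\sum_i nu cl A i - \sum_i \sum_j slack i j * Y i j - mxdot dual_mx Y).
Proof.
move=> Y1; rewrite !mxdotE -!sumrB mulr_sumr; apply: eq_bigr => i _.
have -> : nu cl A i = \sum_j (if i == j then nu cl A i else 0) * Y i j.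
  rewrite (bigD1 i) //= eqxx Y1 mulr1 big1 ?addr0 // => j.
  by rewrite eq_sym => /negbTE->; rewrite mul0r.
rewrite -!sumrB mulr_sumr; apply: eq_bigr => j _.
rewrite !mxE; move: (if _ then _ else _) (slack i j) (Y i j) (A i j) => a s y z.
by field.
Qed.

Lemma mxdot_gram (s : seq 'cV[R]_n) :
  mxdot dual_mx (\sum_(v <- s) v *m v^T) = \sum_(v <- s) dotv v (dual_mx *m v).
Proof.
rewrite mxdotE; elim: s => [|v s IHs].
  by rewrite !big_nil big1 // => i _; rewrite big1 // => j _; rewrite [X in _ * X]mxE mulr0.
rewrite !big_cons -IHs /dotv -big_split; apply: eq_bigr => i _ /=.
rewrite [(dual_mx *m v) i 0]mxE mulr_sumr -big_split; apply: eq_bigr => j _ /=.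
rewrite [X in _ * X]mxE [(v *m _) _ _]mxE big_ord_recl big_ord0 addr0 [v^T _ _]mxE.
by ring.
Qed.

(** Row sums of [dual_mx] are the same over every cluster, while each row of [Y0] is constant on
    clusters with total 0. *)
Lemma mxdot_dual_partition : mxdot dual_mx Y0 = 0.
Proof.
have k1 := k1_gt0 R k2.
pose b : R := (k%:R - 1)^-1; rewrite mxdotE big1 // => i _.
rewrite (sum_by_cluster cl) (eq_bigr (fun t => (m%:R / 2 - c) *
   (if cl i == t then 1 else - b))); last first.
  move=> t _; rewrite -(dual_mx_cluster i t) mulr_suml; apply: eq_bigr => j /eqP jt.
  by rewrite [Y0 _ _]mxE jt.
rewrite -mulr_sumr; apply/eqP; rewrite mulf_eq0; apply/orP; right.
have := partition_mx_cols R bal k2 i.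
rewrite (eq_bigr (fun j => if cl i == cl j then 1 else - b)) => [|j _]; last first.
  by rewrite mxE eq_sym.
rewrite (sum_cluster_fun bal (fun t => if cl i == t then 1 else - b)).
by move/eqP; rewrite mulf_eq0 gt_eqF ?M0.
Qed.

Lemma slack_le (Y : 'M[R]_n) : sdp_feasible k Y ->
  \sum_i \sum_j slack i j * Y0 i j <= \sum_i \sum_j slack i j * Y i j.
Proof.
case=> _ Yge _; apply: ler_sum => i _; apply: ler_sum => j _.
have := slack_ge0 i j; rewrite mxE /slack; case: ifP => _; first by rewrite !mul0r.
by move=> s0; apply: ler_wpM2l.
Qed.

(** The slack vanishes where [c] is attained, so it cannot alone force the entries across clusters.
    Instead, optimality puts every Gram vector of [Y] in the kernel of the dual form: [Y] is 1
    inside clusters and has zero column sums. As [Y - Y0] is entrywise nonnegative, it must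
    vanish. *)
Lemma dual_certificate : sdp_recovers cl A.
Proof.
have Y0f : sdp_feasible k Y0 by exact: (partition_mx_feasible R cl k2).
have Y0v : mxdot (2 *: A - const_mx 1) Y0 =
    2 * (\sum_i nu cl A i - \sum_i \sum_j slack i j * Y0 i j).
  by rewrite mxdot_dual ?mxdot_dual_partition ?subr0 //; case: Y0f.
have Mge0 Y : psdmx Y -> 0 <= mxdot dual_mx Y.
  move=> /psd_gram[s ->]; rewrite mxdot_gram sumr_ge0 // => v _.
  by have [] := dual_mx_psd v.
move=> Y; split=> [[Yf Ymax]|->]; last first.
  split=> // Z Zf; rewrite Y0v mxdot_dual; last by case: Zf.
  have := slack_le Zf; case: Zf => _ _ /Mge0; lra.
have Mle0 : mxdot dual_mx Y <= 0.
  have := Ymax _ Y0f; rewrite Y0v mxdot_dual; last by case: Yf.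
  by have := slack_le Yf; lra.
have [Y1 Yge Ypsd] := Yf; have [s sE] := psd_gram Ypsd.
have vq v : v \in s -> dotv v (dual_mx *m v) = 0.
  move=> vs; move: Mle0; rewrite sE mxdot_gram => le0; apply/eqP.
  rewrite eq_le; have [-> _] := dual_mx_psd v; rewrite andbT.
  apply: le_trans le0; rewrite (big_rem v) //= lerDl sumr_ge0 // => u _.
  by have [] := dual_mx_psd u.
have vE v : v \in s -> (forall i j, cl i = cl j -> v i 0 = v j 0) /\ \sum_i v i 0 = 0.
  by move=> /vq q0; have [_] := dual_mx_psd v; apply.
have YE i j : Y i j = \sum_(v <- s) v i 0 * v j 0.
  rewrite sE summxE; apply: eq_bigr => v _.
  by rewrite mxE big_ord_recl big_ord0 addr0 [v^T _ _]mxE.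
have Yin i j : cl i = cl j -> Y i j = 1.
  move=> ij; rewrite -(Y1 j) !YE big_seq [RHS]big_seq; apply: eq_bigr => v vs.
  by rewrite ((vE v vs).1 _ _ ij).
have Ycol j : \sum_i (Y i j - Y0 i j) = 0.
  rewrite sumrB (partition_mx_cols R bal k2) subr0.
  under eq_bigr do rewrite YE.
  rewrite exchange_big big_seq big1 // => v vs.
  by rewrite -mulr_suml (vE v vs).2 mul0r.
have Ydiff i j : 0 <= Y i j - Y0 i j.
  rewrite mxE; case: eqP => [/Yin ->|_]; first by rewrite subrr.
  by rewrite subr_ge0.
apply/matrixP => i j; apply/eqP; rewrite -subr_eq0.
have := Ycol j; move/eqP; rewrite psumr_eq0 => // /allP/(_ i).
by rewrite mem_index_enum /=; apply.
Qed.

End Certificate.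

(** * Conclusion *)

Section Concentration.
Variables (R : realType) (n k m : nat) (p q : R) (cl : 'I_n -> 'I_k).
Hypotheses (bal : balanced m cl) (k2 : (2 <= k)%N) (m0 : (0 < m)%N) (nkm : n = (k * m)%N).
Hypotheses (p0 : 0 <= p) (q0 : 0 <= q).

Lemma edge_weightE (i j : 'I_n) : edge_weight p q cl (oedge i j) =
  if i == j then 0 else if cl i == cl j then p else q.
Proof.
rewrite /edge_weight; case E : (oedge i j) => [e|] /=; last first.
  by move/eqP: E; rewrite oedge_None => ->.
rewrite -oedge_None E /edge_prob /=.
by move/eqP: E; rewrite oedgeP => /orP[]/eqP-> //=; rewrite eq_sym.
Qed.

Lemma edge_weight_sum (y : 'I_n) :
  \sum_x edge_weight p q cl (oedge x y) <= p * m%:R + q * n%:R.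
Proof.
apply: (@le_trans _ _ (\sum_(x : 'I_n) ((if cl x == cl y then p else 0) + q))).
  apply: ler_sum => x _; rewrite edge_weightE.
  by case: eqP => _; case: eqP => _; rewrite ?addr_ge0 ?lerDl ?add0r.
rewrite big_split /= -big_mkcond (sum_cluster_const bal) sumr_const card_ord.
by rewrite mulrC [q * _]mulr_natr.
Qed.

Lemma adjmxE (G : graph n) : adjmx R G = graph_mx (fun e => (e \in G)%:R).
Proof.
apply/matrixP => i j; rewrite !mxE /Defs.adjacent.
case E : (oedge i j) => [e|] /=; last first.
  case: existsP => // -[e /andP[_]]; rewrite -oedgeP => /eqP E'.
  by rewrite E in E'.
congr _%:R; congr nat_of_bool; apply/existsP/idP => [[e' /andP[eG]]|eG].
  by rewrite -oedgeP E => /eqP[->].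
by exists e; rewrite eG -oedgeP E eqxx.
Qed.

Lemma adjmx_tr (G : graph n) : (adjmx R G)^T = adjmx R G.
Proof. by rewrite adjmxE graph_mx_tr. Qed.

Lemma adjmx_ge0 (G : graph n) i j : 0 <= adjmx R G i j.
Proof. by rewrite mxE. Qed.

Lemma adjmx_le1 (G : graph n) i j : adjmx R G i j <= 1.
Proof. by rewrite mxE; case: (Defs.adjacent _ _ _). Qed.

Definition mean_mx : 'M[R]_n := \matrix_(i, j) edge_weight p q cl (oedge i j).

Lemma adjmx_centered (G : graph n) :
  adjmx R G = graph_mx (centered p q cl G) + mean_mx.
Proof.
rewrite adjmxE; apply/matrixP => i j; rewrite !mxE /edge_weight /centered.
by case: (oedge i j) => [e|] /=; rewrite ?subrK ?addr0.
Qed.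

(** The block part of E A kills centered vectors; only the missing diagonal [p] remains, with a
    favourable sign. *)
Lemma mean_mx_centered (w : 'cV[R]_n) : centered_vec cl w -> mean_mx *m w = - p *: w.
Proof.
move=> wc; apply/matrixP => i j; rewrite ord1 !mxE.
have := centered_vec_sum (fun t => if cl i == t then p else q) wc.
rewrite (bigD1 i) //= eqxx => H.
rewrite (bigD1 i) //= mxE edge_weightE eqxx mul0r add0r.
rewrite (eq_bigr (fun j => w j 0 * (if cl i == cl j then p else q))); first by lra.
by move=> l; rewrite mxE edge_weightE eq_sym => /negbTE->; rewrite mulrC.
Qed.

Variables (G : graph n) (b : R).
Hypotheses (b0 : 0 < b) (p_half : p <= 2^-1).
Hypothesis Xb : opbound (graph_mx (centered p q cl G)) b.
Hypothesis nu_ge : forall i, 2 * b <= nu cl (adjmx R G) i.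

Lemma adjmx_centered_lt (w : 'cV[R]_n) : centered_vec cl w -> w != 0 ->
  dotv w (adjmx R G *m w) < \sum_i nu cl (adjmx R G) i * w i 0 ^+ 2.
Proof.
move=> wc wn; have ww : 0 < dotv w w.
  by rewrite lt_def dotv_ge0 andbT; apply: contraNneq wn => /dotv_eq0 ->.
rewrite adjmx_centered mulmxDl dotvDr mean_mx_centered // dotvZr -adjmx_centered.
apply: (@le_lt_trans _ _ (b * dotv w w)).
  have := opbound_quad w (ltW b0) Xb.
  by have := mulr_ge0 p0 (ltW ww); lra.
apply: (@lt_le_trans _ _ (2 * b * dotv w w)).
  by have := mulr_gt0 b0 ww; lra.
rewrite mulr_sumr; apply: ler_sum => i _.
by rewrite -expr2 ler_wpM2r ?sqr_ge0.
Qed.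

Lemma cross_max_lt : cross_max cl (adjmx R G) < m%:R / 2.
Proof.
set A := adjmx R G; set c := cross_max cl A.
have M0 : 0 < m%:R :> R by rewrite ltr0n.
pose t : 'I_k := Ordinal (ltnW k2).
pose u : 'cV[R]_n := \col_i (if cl i == t then 1 else 0).
have usum (f : 'I_n -> R) : \sum_i u i 0 * f i = \sum_(i | cl i == t) f i.
  rewrite [RHS]big_mkcond; apply: eq_bigr => i _; rewrite mxE.
  by case: ifP => _; rewrite ?mul1r ?mul0r.
have uu : dotv u u = m%:R.
  rewrite /dotv usum (eq_bigr (fun=> 1)) => [|i it]; last by rewrite mxE it.
  by rewrite (sum_cluster_const bal) mulr1.
have umx (Z : 'M[R]_n) : dotv u (Z *m u) = \sum_(i | cl i == t) \sum_(j | cl j == t) Z i j.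
  rewrite /dotv usum; apply: eq_bigr => i _; rewrite mxE -usum.
  by apply: eq_bigr => j _; rewrite mulrC.
have h1 : m%:R * (c + 2 * b) <= dotv u (A *m u).
  rewrite umx -(sum_cluster_const bal t); apply: ler_sum => i /eqP it.
  by have := nu_ge i; rewrite /nu /delta_in /delta_vc it -/A -/c; lra.
have h2 : dotv u (mean_mx *m u) <= m%:R * (m%:R * p).
  rewrite umx -!(sum_cluster_const bal t); apply: ler_sum => i /eqP it.
  apply: ler_sum => j /eqP jt; rewrite mxE edge_weightE it jt eqxx.
  by case: ifP.
have := opbound_quad u (ltW b0) Xb; rewrite uu => h3.
move: h1; rewrite /A adjmx_centered mulmxDl dotvDr => h1.
(* Dividing by [m] gives [c + b <= m * p <= m / 2]; [b > 0] makes the bound on [c] strict. *)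
have : m%:R * (c + 2 * b) <= m%:R * (b + m%:R * p) by lra.
rewrite ler_pM2l // => h4.
have : m%:R * p <= m%:R / 2 by rewrite ler_pM2l.
by move: (b0); lra.
Qed.

Lemma sdp_recovers_of_opbound : sdp_recovers cl (adjmx R G).
Proof.
exact: (dual_certificate bal k2 m0 nkm (adjmx_tr G) cross_max_lt adjmx_centered_lt).
Qed.

End Concentration.

Section ClusterSize.
Variables (R : realType) (n k m : nat) (cl : 'I_n -> 'I_k) (G : graph n).
Hypotheses (bal : balanced m cl) (k2 : (2 <= k)%N) (m0 : (0 < m)%N) (nkm : n = (k * m)%N).

(** An inner degree is at most [m], and [cross_max] is at least [- m] by any pair in different
    clusters. A large lower bound on nu thus forces large clusters. *)
Lemma nu_cluster_size (a : R) : (forall i, a <= nu cl (adjmx R G) i) -> a <= 2 * m%:R.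
Proof.
move=> nua; set A := adjmx R G.
have M0 : 0 < m%:R :> R by rewrite ltr0n.
have mem t : exists i, cl i = t.
  have : (0 < #|[set i | cl i == t]%SET|)%N by rewrite bal.
  by case/card_gt0P => i; rewrite inE => /eqP; exists i.
have [u ut] := mem (Ordinal (ltnW k2)); have [v vt] := mem (Ordinal k2).
have uv : cl u != cl v by rewrite ut vt -val_eqE.
have d1 i t : delta_vc cl A i t <= m%:R.
  rewrite -[leRHS]mulr1 -(sum_cluster_const bal t); apply: ler_sum => j _.
  exact: adjmx_le1.
have d0 i t : 0 <= delta_vc cl A i t by apply: sumr_ge0 => j _; apply: adjmx_ge0.
have dcc s t : delta_cc cl A s t / m%:R <= m%:R.
  rewrite ler_pdivrMr // -(sum_cluster_const bal s); apply: ler_sum => i _.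
  exact: d1.
have := cross_max_ge k2 nkm A uv; rewrite /cross_value.
have := nua u; rewrite /nu /delta_in -/A.
have := d1 u (cl u); have := d0 u (cl v); have := d0 v (cl u).
have := dcc (cl v) (cl u); lra.
Qed.

End ClusterSize.

Lemma power_of_two_near (R : realType) (x : R) : 1 <= x ->
  exists b : nat, x <= (2 ^ b)%:R /\ (2 ^ b)%:R <= 2 * x.
Proof.
move=> x1.
have ex : exists b : nat, x <= (2 ^ b)%:R.
  exists (Num.truncn x).+1; apply: (le_trans (ltW (truncnS_gt x))).
  by rewrite ler_nat ltnW // ltn_expl.
case: (ex_minnP ex) => b xb bmin; exists b; split=> //.
case: b xb bmin => [|b] xb bmin; first by rewrite expn0; lra.
have xlt : (2 ^ b)%:R < x by rewrite ltNge; apply/negP => /bmin; rewrite ltnn.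
by rewrite expnS natrM ler_pM2l // ltW.
Qed.

Lemma ln_le_sqrt (R : realType) (x : R) : 0 < x -> ln x <= 2 * Num.sqrt x.
Proof.
move=> x0; have s0 : 0 < Num.sqrt x by rewrite sqrtr_gt0.
rewrite -[in leLHS](sqr_sqrtr (ltW x0)) lnXn // mulr2n.
by have := ln_sublinear s0; lra.
Qed.

Local Open Scope classical_set_scope.
Local Open Scope ring_scope.

Theorem theorem4 (R : realType) :
  exists chat : R, 0 < chat /\
  forall alpha beta : R,
  exists gamma : R, 0 < gamma /\
  exists n0 : nat,
  forall (n k m : nat) (cl : 'I_n -> 'I_k) (p q : R),
    (2 <= k)%N -> n = (k * m)%N -> (n0 <= n)%N ->
    balanced m cl ->
    p = alpha * (ln m%:R / m%:R) ->
    q = beta * (ln m%:R / m%:R) ->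
    0 <= q -> q < p -> p <= 1 ->
    1 - n%:R `^ (- gamma) <=
    sbm_prob p q cl
      [set G | (forall i : 'I_n,
                  chat * (Num.sqrt (p * n%:R / k%:R + q * n%:R)
                          + Num.sqrt (ln n%:R))
                  <= nu cl (adjmx R G) i) ->
               sdp_recovers cl (adjmx R G)].
Proof.
pose e1 : R := expR 1; pose K : R := moment_cst R.
have e1_ge : 1 <= e1 by apply: le_trans (expR_ge1Dx _); rewrite lerDl.
have K_ge : 1 <= K.
  have := expR_ge1Dx (256 : R).
  by rewrite /K /moment_cst; lra.
have e1_gt0 : 0 < e1 by lra.
have K0 : 0 < K by lra.
(* The requirement is nu at least [2 * b = 4 * e1 * K * s], and [s] is at most twice the sum of the
   two square roots. *)
have [chat chatE] : exists chat, chat = 8 * e1 * K by exists (8 * e1 * K).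
have chat_ge : 8 <= chat by rewrite chatE; nra.
exists chat; split; first by lra.
move=> alpha beta; exists 1; split=> //.
(* From [log n >= L] and [m >= sqrt (log n)] follow [m >= 16 * alpha ^ 2] and [p * m = alpha * log m
   <= 2 * |alpha| * sqrt m <= m / 2]. *)
pose L : R := 1 + (16 * alpha ^+ 2) ^+ 2.
exists (Num.truncn (expR L)).+1 => n k m cl p q k2 nkm n0 bal pE qE q0 qp p1.
have eLn : expR L <= n%:R.
  by apply: (le_trans (ltW (truncnS_gt _))); rewrite ler_nat.
have n_gt0 : 0 < n%:R :> R by apply: lt_le_trans eLn; apply: expR_gt0.
have lnL : L <= ln n%:R by rewrite -(expRK L) ler_ln ?posrE ?expR_gt0.
have ln1 : 1 <= ln n%:R :> R.
  by apply: le_trans lnL; rewrite /L lerDl sqr_ge0.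
have m0 : (0 < m)%N by move: n_gt0; rewrite ltr0n nkm muln_gt0 => /andP[].
have M0 : 0 < m%:R :> R by rewrite ltr0n.
have p0 : 0 <= p by lra.
have -> : p * n%:R / k%:R + q * n%:R = p * m%:R + q * n%:R.
  by rewrite -[p * n%:R / _]mulrA (cluster_size R k2 nkm).
set d := p * m%:R + q * n%:R.
have d0 : 0 <= d by rewrite addr_ge0 // mulr_ge0.
have [a [dP Pd]] := @power_of_two_near R (d + ln n%:R) ltac:(lra).
set P := (2 ^ a)%N in dP Pd; have P0 : (0 < P)%N by rewrite expn_gt0.
have r0 : 0 < (2 * P)%:R :> R by rewrite ltr0n muln_gt0.
pose s : R := Num.sqrt (2 * P)%:R; have s0 : 0 < s by rewrite sqrtr_gt0.
(* The tail is then [2 * n * (2 * e1) ^ (- 2 * P)]: the powers of 2 absorb the leading 2, and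
   [P >= log n] makes the powers of [e1] at most [n ^ (- 2)]. *)
pose b : R := 2 * e1 * (K * s).
have b0 : 0 < b by apply: mulr_gt0; apply: mulr_gt0.
have sle : s <= 2 * (Num.sqrt d + Num.sqrt (ln n%:R)).
  have u0 := sqrtr_ge0 d; have v0 := sqrtr_ge0 (ln n%:R : R).
  rewrite -(@ler_pXn2r _ 2) ?nnegrE ?mulr_ge0 ?addr_ge0 ?(ltW s0) //.
  rewrite sqr_sqrtr ?(ltW r0) // natrM.
  have := sqr_sqrtr d0; have : Num.sqrt (ln n%:R) ^+ 2 = ln n%:R :> R.
    by rewrite sqr_sqrtr //; lra.
  have := mulr_ge0 u0 v0; nra.
have wP y : \sum_x edge_weight p q cl (oedge x y) <= P%:R.
  by apply: le_trans (edge_weight_sum bal p0 q0 y) _; rewrite -/d; lra.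
have p01 : 0 <= p <= 1 by rewrite p0.
have q01 : 0 <= q <= 1 by apply/andP; split; lra.
have tail := trace_tail (cl := cl) p01 q01 P0 b0 wP.
pose bad (G : graph n) := b ^+ (2 * P) < \tr (graph_mx (centered p q cl G) ^+ (2 * P)).
have tail1 : \sum_(G : graph n | bad G) sbm_mass p q cl G <= n%:R `^ (- 1).
  apply: le_trans tail _; rewrite powRN powRr1 ?ler0n // -/K -/s.
  have -> : K * s / b = (2 * e1)^-1.
    by rewrite /b; field; rewrite !gt_eqF.
  rewrite exprVn exprMn invfM.
  have h2 : 2 * (2 ^+ (2 * P))^-1 <= 1 :> R.
    rewrite ler_pdivrMr ?exprn_gt0 // mul1r -[leLHS]expr1 ler_weXn2l ?ler1n //.
    by rewrite muln_gt0.
  have h3 : (e1 ^+ (2 * P))^-1 <= n%:R^-1 * n%:R^-1.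
    rewrite -invfM lef_pV2 ?posrE ?mulr_gt0 ?exprn_gt0 //.
    rewrite -expRM_natl mulr1 -[n%:R]lnK ?posrE // -expRD ler_expR natrM.
    by lra.
  rewrite -[leRHS]mul1r -[2 * n%:R * _](_ : 2 * (2 ^+ (2 * P))^-1 *
    (n%:R * (e1 ^+ (2 * P))^-1) = _); last by ring.
  have n1 : n%:R * (e1 ^+ (2 * P))^-1 <= n%:R^-1.
    by rewrite -ler_pdivlMl // mulrC.
  by apply: ler_pM => //; rewrite mulr_ge0 ?invr_ge0 ?exprn_ge0 // ltW.
have tot := sum_sbm_mass p q cl.
have mass0 G := sbm_mass_ge0 cl p01 q01 G.
rewrite (bigID bad) /= in tot.
apply: (@le_trans _ _ (\sum_(G : graph n | ~~ bad G) sbm_mass p q cl G)); first by lra.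
rewrite /sbm_prob big_mkcond [leRHS]big_mkcond; apply: ler_sum => G _.
case: ifP => [good|_]; last by case: ifP.
suff -> : G \in [set G | (forall i, chat * (Num.sqrt d + Num.sqrt (ln n%:R))
   <= nu cl (adjmx R G) i) -> sdp_recovers cl (adjmx R G)] by [].
rewrite inE => nuG.
have Xb : opbound (graph_mx (centered p q cl G)) b.
  apply: (@opbound_tr_expr _ _ _ b a); rewrite ?graph_mx_tr ?(ltW b0) //.
  by rewrite expnS leNgt.
apply: (sdp_recovers_of_opbound bal k2 m0 nkm p0 b0 _ Xb).
  (* The hypothesis on nu makes m grow with n, hence p <= 1/2. *)
  have m_ge : Num.sqrt (ln n%:R) <= m%:R :> R.
    have u0 := sqrtr_ge0 d; have v0 := sqrtr_ge0 (ln n%:R : R).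
    have := nu_cluster_size bal k2 m0 nkm nuG.
    by have := ler_wpM2r (addr_ge0 u0 v0) chat_ge; lra.
  have lnm := ln_le_sqrt M0; set z : R := Num.sqrt m%:R in lnm.
  have z0 : 0 < z by rewrite sqrtr_gt0.
  have zz : z ^+ 2 = m%:R by rewrite sqr_sqrtr // ltW.
  have ma : 16 * alpha ^+ 2 <= m%:R.
    apply: le_trans m_ge; rewrite -(@ler_pXn2r _ 2) ?nnegrE ?sqrtr_ge0 //;
      last by rewrite mulr_ge0 ?sqr_ge0.
    rewrite sqr_sqrtr; last by lra.
    by apply: le_trans lnL; rewrite /L lerDr.
  have za : 4 * `|alpha| <= z.
    rewrite -(@ler_pXn2r _ 2) ?nnegrE ?mulr_ge0 ?normr_ge0 ?(ltW z0) //.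
    rewrite zz exprMn real_normK ?num_real //.
    by lra.
  rewrite -(ler_pM2r M0) pE mulrA divfK ?gt_eqF // -[in leRHS]zz.
  have lnm0 : 0 <= ln m%:R :> R by rewrite ln_ge0 // ler1n.
  have h1 := ler_wpM2r lnm0 (ler_norm alpha).
  have h2 := ler_wpM2l (normr_ge0 alpha) lnm.
  by have := ler_wpM2r (ltW z0) za; lra.
move=> i; apply: le_trans (nuG i); rewrite /b chatE.
have : e1 * K * s <= e1 * K * (2 * (Num.sqrt d + Num.sqrt (ln n%:R))).
  by rewrite ler_wpM2l // mulr_ge0 ?(ltW e1_gt0) ?(ltW K0).
lra.
Qed.
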